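(* Let $G$ be a finite solvable group and let $\eta$ be a positive real number. If $G$ has the $\eta$-intersection property, then every complemented chief factor of $G$ is a $\lfloor \eta\cdot c\rfloor$-module, where $c$ is the P\'alfy--Wolf constant.
   Context: The P\'alfy--Wolf constant is $c=1+\log_9(48\cdot 24^{1/3})\approx 3.243$ (so that $|V\rtimes H|\le |V|^{c}$ for every finite solvable group $H$ acting faithfully and irreducibly on a finite elementary abelian $p$-group $V$). A maximal intersection in $G$ is a subgroup of $G$ that is an intersection of maximal subgroups of $G$. $G$ has the $\eta$-intersection property if for every maximal intersection $H$ in $G$ there exists a family of maximal subgroups $M_1,\dots,M_t$ of $G$ such that $H=M_1\cap\dots\cap M_t$ and $|G:M_1|\cdots|G:M_t|\le|G:H|^\eta$. A chief factor $X/Y$ of $G$ is complemented if $X/Y$ has a complement in $G/Y$; it is regarded as an irreducible $G$-module by conjugation. Let $V$ be an irreducible $G$-module, $F=\operatorname{End}_G(V)$, and $\gamma$ a positive integer. $V$ is called a $\gamma$-module if for every $F$-subspace $W$ of $V$ there exists an $F$-subspace $W^*$ of $V$ such that (1) $\dim_F(W^* )\le\gamma$, and (2) $C_G(W)=C_G(W^* )\cap\bigl(\bigcap_{M\in\mathcal M_W}M\bigr)$, where $\mathcal M_W$ is the set of maximal subgroups of $G$ containing $C_G(W)$ (an empty intersection being $G$). *)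

(* Defs.v *)
From mathcomp Require Import all_boot all_order all_algebra.
From mathcomp Require Import all_fingroup all_solvable.
From mathcomp Require Import reals exp.

Set Implicit Arguments.
Unset Strict Implicit.
Unset Printing Implicit Defensive.

Import GroupScope.

Definition palfy_wolf (R : realType) : R :=
  (1 + ln (48%:R * (24%:R `^ (3%:R)^-1)) / ln 9%:R)%R.

(* Intersecting with G makes the empty intersection equal to G. *)
Definition meet_in (gT : finGroupType) (G : {group gT})
    (Ms : seq {group gT}) : {set gT} :=
  G :&: \bigcap_(M <- Ms) gval M.

Definition maximal_intersection (gT : finGroupType) (G H : {group gT}) : Prop :=
  exists Ms : seq {group gT},
    (forall M, M \in Ms -> maximal M G) /\ H :=: meet_in G Ms.

Definition intersection_property (R : realType) (gT : finGroupType)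
    (eta : R) (G : {group gT}) : Prop :=
  forall H : {group gT}, maximal_intersection G H ->
  exists Ms : seq {group gT},
    [/\ forall M, M \in Ms -> maximal M G,
        H :=: meet_in G Ms
      & (\prod_(M <- Ms) (#|G : M|%:R : R) <= (#|G : H|%:R : R) `^ eta)%R].

(* A G-module is given by a group action [to] of G on an abelian group V,
   written multiplicatively and with V embedded in an ambient group type rT. *)
Definition irreducible_module (gT rT : finGroupType) (D : {group gT})
    (S : {group rT}) (to : groupAction D S) (G : {group gT})
    (V : {group rT}) : Prop :=
  [/\ G \subset D, abelian V & acts_irreducibly G V to].

(* The elements of F = End_G(V), as maps on rT that only matter on V; the zero
   of F is represented by any map which is constantly 1 on V. *)
Definition module_end (gT rT : finGroupType) (D : {group gT})
    (S : {group rT}) (to : groupAction D S) (G : {group gT})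
    (V : {group rT}) (f : rT -> rT) : Prop :=
  [/\ {in V, forall x, f x \in V},
      {in V &, forall x y, f (x * y) = f x * f y}
    & {in G & V, forall a x, f (to x a) = to (f x) a}].

Definition F_subspace (gT rT : finGroupType) (D : {group gT})
    (S : {group rT}) (to : groupAction D S) (G : {group gT})
    (V W : {group rT}) : Prop :=
  W \subset V /\
  forall f, module_end to G V f -> {in W, forall x, f x \in W}.

(* The product over i of f i (v i) is the linear combination of the vectors
   v i with coefficients f i in F. *)
Definition F_free (gT rT : finGroupType) (D : {group gT})
    (S : {group rT}) (to : groupAction D S) (G : {group gT})
    (V : {group rT}) (d : nat) (v : 'I_d -> rT) : Prop :=
  forall f : 'I_d -> rT -> rT,
    (forall i, module_end to G V (f i)) ->
    \prod_(i < d) f i (v i) = 1 -> forall i, {in V, forall x, f i x = 1}.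

Definition F_generates (gT rT : finGroupType) (D : {group gT})
    (S : {group rT}) (to : groupAction D S) (G : {group gT})
    (V W : {group rT}) (d : nat) (v : 'I_d -> rT) : Prop :=
  forall w, w \in W -> exists f : 'I_d -> rT -> rT,
    (forall i, module_end to G V (f i)) /\ w = \prod_(i < d) f i (v i).

Definition F_dim (gT rT : finGroupType) (D : {group gT})
    (S : {group rT}) (to : groupAction D S) (G : {group gT})
    (V W : {group rT}) (d : nat) : Prop :=
  exists v : 'I_d -> rT,
    [/\ forall i, v i \in W, F_free to G V v & F_generates to G V W v].

Definition maximal_over_meet (gT : finGroupType) (G : {group gT})
    (C : {set gT}) : {set gT} :=
  G :&: \bigcap_(M : {group gT} | maximal M G && (C \subset M)) M.

Definition gamma_module (gT rT : finGroupType) (D : {group gT})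
    (S : {group rT}) (to : groupAction D S) (G : {group gT})
    (V : {group rT}) (gamma : nat) : Prop :=
  [/\ 0 < gamma, irreducible_module to G V
    & forall W : {group rT}, F_subspace to G V W ->
      exists Ws : {group rT},
        [/\ F_subspace to G V Ws,
            exists2 d, F_dim to G V Ws d & d <= gamma
          & 'C_G(W | to) = 'C_G(Ws | to) :&: maximal_over_meet G 'C_G(W | to)]].

(* Main.v *)
(* Let V = X/Y, let L be a complement of V in G/Y and K = C_L(W), the intersection of
   the conjugates L^w with w in W. A family of maximal subgroups with intersection K
   consists of subgroups containing V and of complements of V, which are conjugates
   L^v; the vectors v span W^*. If there are t of them, the eta-intersection property
   gives |V|^t <= |G/Y : K|^eta, and the Palfy-Wolf bound |G/Y : K| <= |V|^c yields
   t <= eta c.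

   The Palfy-Wolf bound |H| 24^(1/3) <= |V|^(c-1) for a solvable irreducible group H on
   V is proved by induction on |V|. Let U be a maximal abelian normal subgroup of H.
   If V is not homogeneous over U, then H permutes the homogeneous components, and
   one combines the bound for the stabiliser of a component with Dixon's bound
   24^((m-1)/3) for solvable permutation groups of degree m, itself a consequence of
   the bound for smaller V. If V is homogeneous, then U spans a field K with
   V = K^d, |H : C_H(U)| <= [K : F_p], and C_H(U) is controlled by a normal subgroup B
   of class 2 with centre U such that B/U is K-linearly independent in M_d(K), whence
   |B/U| <= d^2, while the bound for smaller V applies to the chief factors in B/U. *)

Require Import Defs.
From mathcomp Require Import all_boot all_order all_algebra.
From mathcomp Require Import all_fingroup all_solvable.
From mathcomp Require Import mxrepresentation mxabelem.
From mathcomp Require Import boolp reals exp.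
From mathcomp Require Import zify ring lra.

Set Implicit Arguments.
Unset Strict Implicit.
Unset Printing Implicit Defensive.

Import Order.TTheory GRing.Theory Num.Theory GroupScope.
Local Open Scope ring_scope.

(** * Numerical estimates *)

(** Complements of V need not all be conjugate. The members of the family avoid this difficulty
    because they contain K, hence C_L(V), and a maximal complement of V containing C_L(V) is
    conjugate to L under V. An element of L lies in L^v exactly when it centralises v, so these
    members are recorded by vectors. The remaining members contain V K = C_G(W), so they belong to
    the set M_W of condition (2): they are paid for by the extra intersection there and need no
    vectors.

    The factor 24^(1/3) makes the order bound reproduce itself: permuting k components costs
    24^((k-1)/3), the components themselves contribute k factors 24^(-1/3), and exactly one is left.
    The exponent c - 1 lies between 20/9 and 9/4, and the estimates use only these bounds; the few
    small cases that they do not settle are excluded by the structure of the group. *)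

Section PalfyWolfConstants.

(** Passing from [i] to [i.+1] multiplies the left side by [(i.+1 / i) ^ k]. This ratio decreases,
    so from [i0] on it is at most [(v / u) ^ k <= B]. *)
Lemma expn_ratio_le (k c B u v i0 : nat) : (0 < k)%N -> (0 < u)%N ->
  (i0 ^ k * c <= B ^ i0)%N -> (v ^ k <= B * u ^ k)%N -> (u * i0.+1 <= v * i0)%N ->
  forall i, (i0 <= i)%N -> (i ^ k * c <= B ^ i)%N.
Proof.
move=> k0 u0 base step ratio i; elim: i => [|i IH].
  by rewrite leqn0 => /eqP i00; move: base; rewrite i00.
rewrite leq_eqVlt => /predU1P[<-//|/[!ltnS] le_i]; have {}IH := IH le_i.
have uv : (u * i.+1 <= v * i)%N by nia.
rewrite -(leq_pmul2l (m := u ^ k)) ?expn_gt0 ?u0// mulnA -expnMn.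
apply: (@leq_trans (v ^ k * i ^ k * c)).
  by rewrite -expnMn leq_mul2r leq_exp2r// uv orbT.
by rewrite -mulnA (leq_trans (leq_mul step IH))// expnS; nia.
Qed.

Variable R : realType.

(* With [pw m = m ^ alpha], the form of the Palfy-Wolf bound that is stable under
   the induction is |H| * lam <= pw |V|, with equality for GL(2, 3) on F_3^2. *)
Definition lam : R := 24%:R `^ (3%:R)^-1.
Definition alpha : R := ln (48%:R * lam) / ln 9%:R.

Lemma palfy_wolfE : palfy_wolf R = 1 + alpha.
Proof. by []. Qed.

Lemma lam3 : lam ^+ 3 = 24%:R.
Proof. by rewrite -powR_mulrn ?powR_ge0// -powRrM mulVf ?pnatr_eq0// powRr1. Qed.

Lemma lam_gt0 : 0 < lam.
Proof. by rewrite powR_gt0 ?ltr0n. Qed.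

Lemma lam_ge2 : 2%:R <= lam.
Proof.
rewrite -(ler_pXn2r (n := 3)) ?nnegrE ?ler0n ?(ltW lam_gt0)// lam3.
by rewrite -natrX ler_nat.
Qed.

Lemma lam_le3 : lam <= 3%:R.
Proof.
rewrite -(ler_pXn2r (n := 3)) ?nnegrE ?ler0n ?(ltW lam_gt0)// lam3.
by rewrite -natrX ler_nat.
Qed.

Lemma lam_sqr_ge6 : 6%:R <= lam ^+ 2.
Proof.
have := lam3; have := lam_le3; have := lam_gt0; rewrite exprSr.
by move=> l0 l3 E; rewrite -(ler_pM2r l0) E; lra.
Qed.

Let ln9_gt0 : 0 < ln (9%:R : R). Proof. by rewrite ln_gt0 ?ltr1n. Qed.
Let p48 : 0 < 48%:R * lam. Proof. by rewrite mulr_gt0 ?lam_gt0 ?ltr0n. Qed.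

Lemma powR9_alpha : 9%:R `^ alpha = 48%:R * lam.
Proof. by rewrite /powR pnatr_eq0 /= mulfVK ?gt_eqF// lnK. Qed.

Lemma alpha_le : alpha <= 9%:R / 4%:R.
Proof.
(* The factor 12 clears the denominator 4 and the cube root in [lam]; what remains is 48^12 * 24^4
   <= 9^27. *)
rewrite ler_pdivrMr// -(ler_pM2l (x := 12%:R)) ?ltr0n// mulrA.
have -> : 12%:R * (9%:R / 4%:R) = 27%:R :> R by field.
rewrite !(mulr_natl (ln _)) -!lnXn ?ltr0n// ler_ln ?posrE ?exprn_gt0 ?ltr0n//.
rewrite exprMn (_ : lam ^+ 12 = 24%:R ^+ 4); last by rewrite -lam3 -exprM.
rewrite -!natrX -natrM ler_nat.
lia.
Qed.

Lemma alpha_ge : 20%:R / 9%:R <= alpha.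
Proof.
rewrite ler_pdivlMr// -(ler_pM2l (x := 27%:R)) ?ltr0n// mulrA.
have -> : 27%:R * (20%:R / 9%:R) = 60%:R :> R by field.
rewrite !(mulr_natl (ln _)) -!lnXn ?ltr0n// ler_ln ?posrE ?exprn_gt0 ?ltr0n//.
rewrite exprMn (_ : lam ^+ 27 = 24%:R ^+ 9); last by rewrite -lam3 -exprM.
rewrite -!natrX -natrM ler_nat.
lia.
Qed.

(* Rational exponents are compared through an integer power clearing the denominators. *)
Lemma powR_natX (x e : R) (k l : nat) : 0 <= x -> e * k%:R = l%:R ->
  (x `^ e) ^+ k = x ^+ l.
Proof.
by move=> x0 ekl; rewrite -powR_mulrn ?powR_ge0// -powRrM ekl powR_mulrn.
Qed.

Definition pw (m : nat) : R := m%:R `^ alpha.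

Lemma pw_ge0 m : 0 <= pw m. Proof. exact: powR_ge0. Qed.

Lemma pw1 : pw 1 = 1. Proof. by rewrite /pw powR1. Qed.

Lemma pwM m n : pw (m * n) = pw m * pw n.
Proof. by rewrite /pw natrM powRM. Qed.

Lemma pwX m k : pw (m ^ k) = pw m ^+ k.
Proof. by elim: k => [|k IH]; rewrite ?pw1// expnS exprS pwM IH. Qed.

Lemma alpha_ge0 : 0 <= alpha.
Proof. by rewrite (le_trans _ alpha_ge)// divr_ge0. Qed.

Lemma pw_le m n : (m <= n)%N -> pw m <= pw n.
Proof. by move=> mn; apply: ge0_ler_powR; rewrite ?alpha_ge0 ?nnegrE ?ler0n ?ler_nat. Qed.

(** The power 36 clears the denominators of 9/4 and 20/9 together, giving the exponents 81 and 80,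
    so that upper and lower bounds can be compared. *)
Lemma pwX36_le m : (0 < m)%N -> pw m ^+ 36 <= m%:R ^+ 81.
Proof.
move=> m0; have <- : (m%:R `^ (9%:R / 4%:R)) ^+ 36 = m%:R ^+ 81 :> R.
  by apply: powR_natX => //; field.
by rewrite ler_pXn2r ?nnegrE ?powR_ge0// ler_powR ?alpha_le ?ler1n.
Qed.

Lemma pwX36_ge m : (0 < m)%N -> m%:R ^+ 80 <= pw m ^+ 36.
Proof.
move=> m0; have <- : (m%:R `^ (20%:R / 9%:R)) ^+ 36 = m%:R ^+ 80 :> R.
  by apply: powR_natX => //; field.
by rewrite ler_pXn2r ?nnegrE ?powR_ge0// ler_powR ?alpha_ge ?ler1n.
Qed.

(** A primitive solvable group of degree [m] has order at most [m * pw m / lam], so this yields the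
    exponent [m - 1] of Dixon's bound. The inequality fails for [m] = 2, 3, 4, where [m!] is used
    instead. *)
Lemma pw_le_lam m : (5 <= m)%N -> m%:R * pw m <= lam ^+ m.
Proof.
move=> m5; have m0 : (0 < m)%N by lia.
have lam0 := ltW lam_gt0.
rewrite -(ler_pXn2r (n := 36)) ?nnegrE ?mulr_ge0 ?pw_ge0 ?exprn_ge0//.
rewrite exprMn (le_trans (ler_wpM2l _ (pwX36_le m0))) ?exprn_ge0//.
rewrite -exprD -exprM mulnC -[36%N]/(3 * 12)%N -mulnA exprM lam3 -!natrX ler_nat.
have H : (m ^ 39 * 1 <= (24 ^ 4) ^ m)%N by apply: (@expn_ratio_le _ _ _ 5 6 5); lia.
rewrite muln1 in H.
by rewrite -[(3 * 12 + 81)%N]/(39 * 3)%N -[12%N]/(4 * 3)%N mulnAC !expnM leq_exp2r.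
Qed.

(** The exponent of [E] is 36 + 81: alpha is bounded above on the left side and below on the right
    one. *)
Lemma pwX36_prod (x E N : nat) : (0 < E)%N -> (0 < N)%N ->
  (x ^ 36 * E ^ 117 <= N ^ 80)%N -> x%:R * E%:R * pw E <= pw N.
Proof.
move=> E0 N0 le_xEN.
rewrite -(ler_pXn2r (n := 36)) ?nnegrE ?mulr_ge0 ?pw_ge0//.
apply: le_trans (pwX36_ge N0); rewrite !exprMn.
rewrite (le_trans (ler_wpM2l _ (pwX36_le E0))) ?mulr_ge0 ?exprn_ge0//.
by rewrite -mulrA -exprD -!natrX -natrM ler_nat.
Qed.

Lemma expn_sqr_le (E d k : nat) : (0 < k)%N -> (E <= d * d)%N -> (E ^ k <= d ^ (k * 2))%N.
Proof. by move=> k0 Ed; rewrite mulnC expnM -mulnn leq_exp2r. Qed.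

Lemma expn_ratio_sqr (d k a l b e : nat) : (d ^ k * a ^ l <= (b ^ e) ^ d)%N ->
  (d ^ (k * 2) * a ^ (l * 2) <= b ^ (e * d * 2))%N.
Proof.
by move=> H; rewrite !expnM -expnMn -(expnM b) leq_exp2r // expnM.
Qed.

Lemma class2_expn_bound3 (d E : nat) : (3 < d)%N -> (E <= d * d)%N ->
  (2 ^ 36 * E ^ 117 <= 3 ^ (80 * d))%N.
Proof.
move=> d4 Ed; rewrite mulnC.
have H : (d ^ 117 * 2 ^ 18 <= (3 ^ 40) ^ d)%N by apply: (@expn_ratio_le _ _ _ 4 5 4); lia.
have {}H := expn_ratio_sqr H.
have -> : (80 * d = 40 * d * 2)%N by clear; lia.
rewrite (leq_trans _ H) // leq_mul2r; apply/orP; right; exact: expn_sqr_le.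
Qed.

(** The 36th power of the estimate [t * Q.-1 <= Q ^ 2 / 2] takes [Q ^ 72] from [Q ^ (80 * d)] and
    gives back [2 ^ 36]. At [Q = 4], [d = 2] the value [E = 4] violates the inequality;
    [class2_pchar2_abelian] rules it out. *)
Lemma class2_expn_bound4 (Q d E : nat) : (E <= d * d)%N ->
    [|| (3 < Q) && (2 < d), (4 < Q) && (d == 2) | [&& Q == 4, d == 2 & E <= 3]]%N ->
  (E ^ 117 <= 2 ^ 36 * Q ^ (80 * d - 72))%N.
Proof.
move=> Ed /or3P[/andP[Q4 d3]|/andP[Q5 /eqP dE]|/and3P[/eqP-> /eqP-> E3]].
- have le4 : (2 ^ 36 * 4 ^ (80 * d - 72) <= 2 ^ 36 * Q ^ (80 * d - 72))%N.
    by rewrite leq_pmul2l ?expn_gt0// leq_exp2r//; move: d3; clear; lia.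
  apply: leq_trans le4.
  have H : (d ^ 117 * 2 ^ 54 <= (2 ^ 80) ^ d)%N.
    by move: d3; clear => d3; apply: (@expn_ratio_le _ _ _ 3 4 3); lia.
  have {}H := expn_ratio_sqr H.
  rewrite -(@leq_pmul2r (2 ^ (54 * 2))) ?expn_gt0//.
  apply: leq_trans (leq_trans H _).
    by rewrite leq_mul2r; apply/orP; right; exact: expn_sqr_le.
  rewrite (_ : 4 ^ (80 * d - 72) = 2 ^ (2 * (80 * d - 72)))%N; last by rewrite expnM.
  rewrite -!expnD leq_exp2l//; move: d3; clear; lia.
- apply: (@leq_trans (4 ^ 117)); first by rewrite leq_exp2r//; move: Ed; rewrite dE.
  apply: (@leq_trans (2 ^ 36 * 5 ^ 88)); first by clear; lia.
  by rewrite leq_pmul2l ?expn_gt0// dE leq_exp2r.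
- rewrite -[(80 * 2 - 72)%N]/88%N.
  by apply: (@leq_trans (3 ^ 117)); [rewrite leq_exp2r | clear; lia].
Qed.

(* The order bound in the homogeneous case: [Q] is the size of a simple module
   of the maximal abelian normal subgroup [U], [t] bounds |G : C_G(U)|, and
   [E = |B / U|] for a normal subgroup [B] of class 2 whose centre is [U]. *)
Lemma pw_class2_bound (Q t d E : nat) : (2 * t <= Q)%N -> (0 < E <= d * d)%N ->
    [|| (3 < Q) && (2 < d), (4 < Q) && (d == 2),
        [&& Q == 4, d == 2 & E <= 3] | (Q == 3) && (3 < d)]%N ->
  (t * Q.-1)%:R * E%:R * pw E <= pw (Q ^ d).
Proof.
move=> tQ /andP[E0 Ed] cases.
have Q0 : (0 < Q)%N by case: (Q) cases.
apply: pwX36_prod; rewrite ?expn_gt0 ?Q0//.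
have [Q3|Q3] := eqVneq Q 3.
  have d4 : (3 < d)%N by lia.
  have tQ2 : (t * Q.-1 <= 2)%N by rewrite Q3; lia.
  rewrite -expnM [(d * 80)%N]mulnC Q3; apply: leq_trans (class2_expn_bound3 d4 Ed).
  by rewrite leq_mul2r leq_exp2r -?Q3// tQ2 orbT.
have d1 : (1 < d)%N by lia.
have tQ2 : (2 * (t * Q.-1) <= Q ^ 2)%N by rewrite -mulnn; nia.
have /(class2_expn_bound4 Ed) EQ :
  [|| (3 < Q) && (2 < d), (4 < Q) && (d == 2) | [&& Q == 4, d == 2 & E <= 3]]%N by lia.
rewrite -(@leq_pmul2l (2 ^ 36)) ?expn_gt0// mulnA -expnMn.
apply: (@leq_trans ((Q ^ 2) ^ 36 * (2 ^ 36 * Q ^ (80 * d - 72)))).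
  by rewrite leq_mul// leq_exp2r.
rewrite mulnCA leq_mul2l -expnM -expnD -expnM; apply/orP; right.
by rewrite leq_exp2l; move: d1 cases; clear; lia.
Qed.

Lemma leq_double_expn (p t : nat) : (1 < p)%N -> (2 * t <= p ^ t)%N.
Proof.
move=> p1; apply: (@leq_trans (2 ^ t)); last by case: t => // t; rewrite leq_exp2r.
elim: t => // t IH; rewrite expnS; case: t IH => [|t] //; rewrite expnS; lia.
Qed.

(** The integer on the left is the order of the group of semilinear maps of a line over the field
    with [p ^ t] elements. As [lam <= 3] and [alpha >= 2], it mostly suffices that 3 t (Q - 1) <=
    Q^2. *)
Lemma pw_semilinear_bound (p t : nat) : (1 < p)%N -> (0 < t)%N ->
  (t * (p ^ t).-1)%:R * lam <= pw (p ^ t).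
Proof.
move=> p1 t0; set Q := (p ^ t)%N.
have Q1 : (1 < Q)%N by rewrite /Q -(exp1n t) ltn_exp2r.
have cases : [|| t == 1, (t == 2) && (3 < Q), (t == 3) && (7 < Q) |
                 (3 < t) && (3 * t <= Q)]%N.
  have : (2 ^ t <= Q)%N by rewrite /Q leq_exp2r.
  move: Q {Q1} => Q; case: t t0 => [|[|[|[|t]]]] //= _ leQ.
  - by rewrite orbF; apply: leq_trans leQ.
  - by rewrite orbF; apply: leq_trans leQ.
  by apply: leq_trans leQ; elim: t => // t; rewrite !expnS; lia.
apply: le_trans (ler_wpM2l _ lam_le3) _; rewrite ?ler0n// -natrM.
(* The one exception: for [Q = 4] and [t = 2] the left side is 18 > 16, and the bound 20/9 for alpha
   is needed. *)
have [/andP[/eqP-> /eqP->]|ex] := boolP ((Q == 4) && (t == 2))%N.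
  have le18 : (18 ^ 36 * 1 ^ 117 <= 4 ^ 80)%N by lia.
  by have := @pwX36_prod 18 1 4 isT isT le18; rewrite pw1 !mulr1.
apply: (@le_trans _ _ ((Q ^ 2)%:R)); first by rewrite ler_nat; clear -cases ex Q1; nia.
rewrite natrX -powR_mulrn ?ler0n// ler_powR ?ler1n ?(ltnW Q1)//.
by rewrite (le_trans _ alpha_ge)//; lra.
Qed.

End PalfyWolfConstants.

(** * Indices and solvable permutation groups *)

Section Indices.
Variable gT : finGroupType.
Implicit Types (G H K L N : {group gT}).

Lemma leq_indexgI N H K : (#|N : H :&: K| <= #|N : H| * #|N : K|)%N.
Proof.
rewrite -[leqLHS]indexgI -(indexgI N H).
rewrite -(@Lagrange_index _ N (N :&: H) (N :&: (H :&: K))) ?subsetIl//; last first.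
  by rewrite setIS// subsetIl.
apply: leq_mul => //; rewrite /= setIA -(indexgI (N :&: H)) /= setIA setIid indexgI.
by apply: subset_leq_card; apply: imsetS; rewrite subsetIl.
Qed.

Lemma leq_index_bigcap N (I : finType) (P : pred I) (C : I -> {group gT}) :
  (#|N : \bigcap_(i | P i) C i| <= \prod_(i | P i) #|N : C i|)%N.
Proof.
suff: exists2 K : {group gT}, \bigcap_(i | P i) C i = K :> {set gT} &
    (#|N : K| <= \prod_(i | P i) #|N : C i|)%N by case=> K ->.
apply: (big_rec2 (fun (A : {set gT}) m =>
  exists2 K : {group gT}, A = K & (#|N : K| <= m)%N)).
  by exists setT%G => //; rewrite -indexgI setIT indexgg.
move=> i A m _ [K -> le_m]; exists (C i :&: K)%G => //.
by rewrite (leq_trans (leq_indexgI _ _ _))// leq_mul2l le_m orbT.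
Qed.

Lemma leq_index_astab (aT : finGroupType) (rT : finType) (G : {group aT})
    (to : {action aT &-> rT}) (S : {set rT}) :
  [acts G, on S | to] -> (#|G : 'C_G(S | to)| <= #|S|`!)%N.
Proof.
elim/ltn_ind: {S}#|S| {-2}S (erefl #|S|) G => m IH S Sm G actS.
have [->|[x Sx]] := set_0Vmem S.
  have -> : 'C_G(set0 | to) = G.
    by apply/setIidPl/subsetP=> a _; rewrite inE in_setT inE sub0set.
  by rewrite indexgg fact_gt0.
have sOS : orbit to G x \subset S by rewrite acts_sub_orbit.
have actx : [acts 'C_G[x | to], on S :\ x | to].
  rewrite setDE; apply/subsetP => a /setIP[Ga /astab1P xa].
  rewrite !inE; apply/subsetP => y; rewrite !inE => /andP[Sy yx].
  rewrite (acts_act actS)// Sy /=; apply: contraNneq yx => toy.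
  by rewrite -(inj_eq (act_inj to a)) xa toy.
have cS : #|S| = #|S :\ x|.+1 by rewrite (cardsD1 x) Sx.
have := IH #|S :\ x| _ (S :\ x) erefl _ actx; rewrite -Sm cS leqnn => /(_ isT) le1.
rewrite -(@Lagrange_index _ G 'C_G[x | to] 'C_G(S | to)) ?subsetIl//; last first.
  by rewrite setIS// astabS// sub1set.
rewrite factS leq_mul//; first by rewrite -card_orbit -cS subset_leq_card.
rewrite (leq_trans _ le1)//; apply: eq_leq.
have eC : 'C_G(S | to) = 'C_('C_G[x | to])(S :\ x | to).
  by rewrite -[in LHS](setD1K Sx) astabU setIA.
exact: (congr1 (fun A : {set aT} => #|'C_G[x | to] : A|) eC).
Qed.

Lemma leq_index_gcore_fact G L : L \subset G -> (#|G : gcore L G| <= #|G : L|`!)%N.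
Proof.
move=> sLG; have := @leq_index_astab _ _ G 'Rs%act (rcosets L G) (actsRs_rcosets _ _).
by rewrite astabRs_rcosets indexgI.
Qed.
End Indices.

Local Open Scope group_scope.

(* Dividing by [rker rG] lets the induction hypothesis apply to the stabiliser of
   a Clifford component, which need not act faithfully on it. *)
Definition pw_below (R : realType) (N : nat) : Prop :=
  forall (p : nat) (gT : finGroupType) (G : {group gT}) (n : nat)
    (rG : mx_representation 'F_p G n),
  prime p -> solvable G -> mx_irreducible rG -> (p ^ n < N)%N ->
  (#|G : rker rG|%:R * lam R <= pw R (p ^ n))%R.

Lemma pw_belowS (R : realType) (M N : nat) : (M <= N)%N -> pw_below R N -> pw_below R M.
Proof. by move=> MN IH p gT G n rG p_pr sG irr lt; apply: IH => //; apply: leq_trans MN. Qed.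

Section Dixon.
Variable R : realType.

Lemma pw_minnormal (N : nat) (gT : finGroupType) (G V : {group gT}) :
  pw_below R N -> solvable G -> minnormal V G -> V \subset G -> (#|V| < N)%N ->
  (#|G : 'C_G(V)|%:R * lam R <= pw R #|V|)%R.
Proof.
move=> IH solG minV sVG ltN.
have [nVG ntV /is_abelemP[p p_pr abelV]] := minnormal_solvable minV sVG solG.
have irrV : mx_irreducible (abelem_repr abelV ntV nVG) by apply/abelem_mx_irrP.
have cV : (p ^ 'dim V)%N = #|V|.
  by rewrite (dim_abelemE abelV ntV) -(card_pgroup (abelem_pgroup abelV)).
by have := IH _ _ _ _ _ p_pr solG irrV; rewrite rker_abelem cV; apply.
Qed.

Lemma gcore_quotient (gT : finGroupType) (G L : {group gT}) : L \subset G ->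
  gcore (L / gcore L G) (G / gcore L G) = 1.
Proof.
move=> sLG; have nsKG := gcore_normal sLG; have nKG := gcore_norm L G.
set K := gcore L G in nsKG nKG *; set N := gcore _ _.
have sNL : N \subset L / K by apply: gcore_sub.
have nNG : G / K \subset 'N(N) by apply: gcore_norm.
have sKL : K \subset L by apply: gcore_sub.
have nsKL : K <| L by apply: normalS nsKG.
have sNK : coset K @*^-1 N \subset K.
  rewrite {2}/K sub_gcore.
    by rewrite -{2}(quotientGK nsKL) morphpreS.
  rewrite -{1}(quotientGK nsKG); apply: subset_trans (morphpre_norm _ _).
  exact: morphpreS.
by rewrite -(cosetpreK N); apply/trivgP; rewrite -(trivg_quotient K) quotientS.
Qed.

(** Both [L :&: V] and [L :&: 'C_G(V)] are normalised by [L] and centralised by [V], and [L] and [V]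
    generate [G]; so they lie in the trivial core of [L]. *)
Lemma primitive_complement (gT : finGroupType) (G L : {group gT}) :
  solvable G -> maximal L G -> gcore L G = 1 ->
  exists2 V : {group gT}, minnormal V G /\ V \subset G &
    #|V| = #|G : L| /\ (#|L| <= #|G : 'C_G(V)|)%N.
Proof.
move=> solG maxL coreL.
have [ltLG maxLG] := maxgroupP maxL; have sLG := proper_sub ltLG.
have [|V minV sVG] := @minnormal_exists _ G G _ (normG G).
  by apply: contraTneq ltLG => ->; rewrite properE sub1G andbF.
have [nVG ntV /is_abelemP[p p_pr abelV]] := minnormal_solvable minV sVG solG.
have normal_triv (A : {group gT}) : A \subset L -> G \subset 'N(A) -> A :=: 1.
  by move=> sAL nAG; apply/trivgP; rewrite -coreL; apply: gcore_max.
have nVL := subset_trans sLG nVG.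
have defG : L <*> V = G.
  have sLV : L <*> V \subset G by rewrite join_subG sLG.
  apply/eqP; rewrite eqEsubset sLV; apply/negPn/negP => nsub.
  have prLV : (L <*> V)%G \proper G by rewrite properE sLV.
  have LVE := maxLG _ prLV (joing_subl _ _).
  have sVL : V \subset L by rewrite -LVE joing_subr.
  by case/eqP: ntV; apply: normal_triv.
have defG' : L * V = G by rewrite -norm_joinEl.
have cVV := abelem_abelian abelV.
have tiLV : L :&: V = 1.
  have nI : G \subset 'N(L :&: V).
    rewrite -defG join_subG; apply/andP; split; first by rewrite normsI ?normG.
    by rewrite cents_norm// centsC (subset_trans (subsetIr _ _)).
  exact: (normal_triv (L :&: V)%G (subsetIl _ _) nI).
have tiLC : L :&: 'C_G(V) = 1.
  have nI : G \subset 'N(L :&: 'C_G(V)).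
    rewrite -{1}defG join_subG; apply/andP; split.
      by rewrite normsI ?normG// normsI ?norms_cent// normsG.
    by rewrite cents_norm// centsC (subset_trans (subsetIr _ _)) ?subsetIr.
  exact: (normal_triv (L :&: 'C_G(V))%G (subsetIl _ _) nI).
exists V; first by [].
have oG : #|G| = (#|L| * #|V|)%N by rewrite -defG' (TI_cardMg tiLV).
split; first by rewrite -divgS// oG mulKn.
rewrite -(leq_pmul2l (cardG_gt0 'C_G(V))) Lagrange ?subsetIl// mulnC.
by rewrite -(TI_cardMg tiLC) subset_leq_card// mul_subG ?subsetIl.
Qed.

Lemma primitive_bound (gT : finGroupType) (G L : {group gT}) :
  pw_below R #|G : L|.+1 -> solvable G -> maximal L G ->
  (#|G : gcore L G|%:R <= lam R ^+ #|G : L|.-1)%R.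
Proof.
move=> IH solG maxL; have sLG : L \subset G := proper_sub (maxgroupp maxL).
set m := #|G : L|; have m0 : (0 < m)%N by rewrite indexg_gt0.
(* Degrees up to 4: the orders 1, 2, 6, 24 are at most 1, [lam], [lam ^ 2], [lam ^ 3], with equality
   for degree 4. This is where the cube root of 24 comes from. *)
have [m5|m4] := leqP 5 m; last first.
  apply: (@le_trans _ _ (m`!)%:R); first by rewrite ler_nat leq_index_gcore_fact.
  have [lam2 lam6 lam24] := And3 (lam_ge2 R) (lam_sqr_ge6 R) (lam3 R).
  by move: m4 m0; case: m => [|[|[|[|[|m]]]]] //= _ _; rewrite lam24.
pose K := gcore L G.
have nsKG : K <| G := gcore_normal sLG.
have nKG := normal_norm nsKG.
have sKL : K \subset L := gcore_sub _ _.
have nsKL : K <| L by apply: normalS nsKG.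
have maxL' : maximal (L / K) (G / K) by rewrite quotient_maximal.
have [V [minV sVG] [oV leL]] :=
  primitive_complement (quotient_sol K solG) maxL' (gcore_quotient sLG).
have indE : #|G / K : L / K| = m.
  by rewrite index_quotient_eq// (subset_trans (subsetIr _ _)).
rewrite indE in oV.
have := pw_minnormal IH (quotient_sol K solG) minV sVG; rewrite oV ltnSn => /(_ isT).
move=> le1; rewrite -(ler_pM2r (lam_gt0 R)).
have -> : #|G : K| = (#|L / K| * m)%N.
  by rewrite -card_quotient// -indE Lagrange// quotientS.
rewrite -exprSr prednK// (le_trans _ (pw_le_lam R m5))// natrM mulrAC mulrC.
rewrite ler_wpM2l// (le_trans _ le1)// ler_pM2r ?lam_gt0// ler_nat.
by [].
Qed.

(** If [L < M < G] with a = |M : L| and b = |G : M|, then [G] permutes b blocks of size a, and the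
    kernel [N] embeds in the product of the groups induced on the blocks. The exponents add up: (b -
    1) + b (a - 1) = a b - 1. *)
Lemma solvable_perm_bound (gT : finGroupType) (G L : {group gT}) :
  L \subset G -> solvable G -> pw_below R #|G : L|.+1 ->
  (#|G : gcore L G|%:R <= lam R ^+ #|G : L|.-1)%R.
Proof.
move: {2}_.+1 (ltnSn #|G : L|) => k.
elim: k => // k IHk in G L *; rewrite ltnS => le_k sLG solG IH.
have [eLG|[M maxM sLM]] := maximal_exists sLG.
  have -> : gcore L G = G.
    apply/eqP; rewrite eqEsubset eLG.
    by rewrite gcore_sub (@gcore_max _ _ _ G) ?normG.
  by rewrite indexgg exprn_ege1 //; apply: le_trans (lam_ge2 R); rewrite ler1n.
have [eML|neML] := eqVneq L M; first by rewrite -eML in maxM; apply: primitive_bound.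
have [ltMG _] := maxgroupP maxM; have sMG := proper_sub ltMG.
have ltLM : L \proper M by rewrite properEneq sLM andbT.
have iE := Lagrange_index sMG sLM.
have iM1 : (1 < #|G : M|)%N by rewrite indexg_gt1 proper_subn.
have iL1 : (1 < #|M : L|)%N by rewrite indexg_gt1 proper_subn.
have ltM : (#|M : L| < #|G : L|)%N by rewrite -iE; nia.
have ltG : (#|G : M| < #|G : L|)%N by rewrite -iE; nia.
have le1 := IHk M L (leq_trans ltM le_k) sLM (solvableS sMG solG) (pw_belowS (leqW ltM) IH).
have le2 := IHk G M (leq_trans ltG le_k) sMG solG (pw_belowS (leqW ltG) IH).
set N := gcore M G in le2.
(* [C X] fixes every point of the block [X]; the choice of representative is harmless because
   [gcore L M] is normal in [M]. *)
pose C (X : {set gT}) : {group gT} := (gcore L M :^ repr X)%G.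
have repP X : X \in rcosets M G -> repr X \in G /\ X = M :* repr X.
  case/rcosetsP=> x Gx ->; split; last by rewrite rcoset_repr.
  have : repr (M :* x) \in M :* x by rewrite mem_repr_rcoset.
  by case/rcosetP=> m Mm ->; rewrite groupM// (subsetP sMG).
have sIC : N :&: \bigcap_(X in rcosets M G) C X \subset gcore L G.
  apply/subsetP=> z /setIP[_ /bigcapP Cz]; apply/bigcapP=> x Gx.
  have XM : M :* x \in rcosets M G by apply/rcosetsP; exists x.
  have := Cz _ XM; rewrite /C /=; have /rcosetP[m Mm ->] : repr (M :* x) \in M :* x.
    exact: mem_repr_rcoset.
  rewrite conjsgM (normsP (gcore_norm L M))//.
  by apply/subsetP; rewrite conjSg gcore_sub.
have sCore : gcore L G \subset N.
  by rewrite sub_gcore ?gcore_norm// (subset_trans (gcore_sub _ _)).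
have leN : (#|N : gcore L G| <= #|M : gcore L M| ^ #|G : M|)%N.
  apply: (@leq_trans #|N : \bigcap_(X in rcosets M G) C X|).
    rewrite -[leqRHS]indexgI; apply: dvdn_leq => //; apply: indexgS.
    exact: sIC.
  apply: leq_trans (leq_index_bigcap _ _ _) _.
  rewrite -prod_nat_const; apply: leq_prod => X /repP[Gx _].
  rewrite -(indexJg M _ (repr X)).
  apply: subset_leq_card; apply: imsetS; rewrite /N.
  by apply: bigcap_inf.
have sNG : N \subset G := subset_trans (gcore_sub _ _) sMG.
have <- := Lagrange_index sNG sCore; rewrite natrM.
apply: (@le_trans _ _ (lam R ^+ #|G : M|.-1 * (lam R ^+ #|M : L|.-1) ^+ #|G : M|)%R).
  rewrite ler_pM ?ler0n//; apply: (@le_trans _ _ (#|M : gcore L M| ^ #|G : M|)%:R%R).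
    by rewrite ler_nat.
  by rewrite natrX lerXn2r// nnegrE ?exprn_ge0 ?(ltW (lam_gt0 R)).
rewrite -exprM -exprD ler_weXn2l//; first by apply: le_trans (lam_ge2 R); rewrite ler1n.
rewrite -iE; case: #|G : M| iM1 => // b _; case: #|M : L| iL1 => // a _ /=.
by clear; nia.
Qed.

End Dixon.

(** * Linear groups: the imprimitive case *)

Section Imprimitive.
Variable R : realType.

Lemma rker_sub_socle (F : fieldType) (gT : finGroupType) (G N : {group gT}) n
    (rG : mx_representation F G n) (nsNG : N <| G)
    (sN : socleType (subg_repr rG (normal_sub nsNG))) :
  mx_irreducible rG -> G :&: \bigcap_(W : sN) rstab rG W \subset rker rG.
Proof.
move=> irrG; apply/subsetP=> x /setIP[Gx /bigcapP Cx]; rewrite inE Gx /=.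
have W1 : (1%:M <= \sum_(W : sN) W)%MS by rewrite -(Clifford_Socle1 irrG sN) /Socle.
have /sub_sumsmxP[u ->] := W1; rewrite mulmx_suml; apply/eqP/eq_bigr=> W _.
have := Cx W isT; rewrite inE => /andP[_ /eqP WxW].
by rewrite -mulmxA WxW.
Qed.

Lemma simple_rstabs_bound (p : nat) (gT : finGroupType) (G : {group gT}) n
    (rG : mx_representation 'F_p G n) (S : {group gT}) (sSG : S \subset G) (W : 'M_n) :
  prime p -> solvable G -> mxsimple (subg_repr rG sSG) W -> pw_below R (p ^ n) ->
  (\rank W < n)%N -> (#|S : rstab rG W|%:R * lam R <= pw R (p ^ \rank W))%R.
Proof.
move=> p_pr solG simW IH ltW; have [modW _ _] := simW.
have irrW : mx_irreducible (submod_repr modW) by apply/submod_mx_irr.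
have ltp : (p ^ \rank W < p ^ n)%N by rewrite ltn_exp2l ?prime_gt1.
have := IH _ _ _ _ _ p_pr (solvableS sSG solG) irrW ltp.
by rewrite rker_submod rstab_subg indexgI.
Qed.

(** The kernel [C] of the action on the k components embeds in the product of the groups induced on
    them, each of order at most [pw (p ^ r) / lam], where r is the rank of a component; multiplied
    by [lam ^ (k - 1)] this is [pw (p ^ n) / lam]. *)
Lemma imprimitive_bound (p : nat) (gT : finGroupType) (G N : {group gT}) n
    (rG : mx_representation 'F_p G n) (nsNG : N <| G)
    (sN : socleType (subg_repr rG (normal_sub nsNG))) :
  prime p -> solvable G -> mx_irreducible rG -> pw_below R (p ^ n) -> (1 < #|sN|)%N ->
  (#|G : rker rG|%:R * lam R <= pw R (p ^ n))%R.
Proof.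
move=> p_pr solG irrG IH gt1; pose k := #|sN|.
have [W1 _ defW1] := imsetP (Clifford_atrans irrG sN).
pose S := [group of rstabs rG W1].
have sSG : S \subset G := rstabs_sub _ _.
have oS : #|G : S| = k.
  by rewrite /k -cardsT defW1 card_orbit_in// Clifford_astab1 indexgI.
have rkE (W : sN) : (k * \rank W)%N = n := Clifford_rank_components irrG W.
have rW (W : sN) : \rank W = \rank W1.
  by apply/eqP; rewrite -(eqn_pmul2l (m := k)) ?rkE//; rewrite /k; lia.
have r0 : (0 < \rank W1)%N by rewrite lt0n mxrank_eq0 nz_socle.
have ltr : (\rank W1 < n)%N by rewrite -[X in (_ < X)%N](rkE W1) ltn_Pmull.
have ltk : (k < p ^ n)%N.
  apply: (@leq_ltn_trans n); first by rewrite -[X in (_ <= X)%N](rkE W1) leq_pmulr.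
  exact/ltn_expl/prime_gt1.
have := solvable_perm_bound sSG solG; rewrite oS => /(_ R (pw_belowS ltk IH)) le1.
set C := gcore S G in le1.
have sCG : C \subset G by rewrite (subset_trans (gcore_sub _ _)).
have sCW (W : sN) : C \subset rstabs rG W.
  have /imsetP[x Gx ->] : W \in orbit (Clifford_action sN) G W1 by rewrite -defW1 inE.
  apply/subsetP=> c Cc; rewrite inE (subsetP sCG)//=.
  have WxE := val_Clifford_act W1 Gx.
  rewrite (eqmxMr _ WxE) WxE -mulmxA -repr_mxM ?(subsetP sCG c)// conjgCV.
  have Ccx : c ^ x^-1 \in C.
    by rewrite memJ_norm// groupV (subsetP (gcore_norm _ _)).
  rewrite repr_mxM ?(subsetP sCG _ Ccx)// mulmxA submxMr//.
  by have /(subsetP (gcore_sub _ _)) := Ccx; rewrite inE => /andP[].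
have sKC : rker rG \subset C.
  rewrite sub_gcore ?rker_norm//; apply/subsetP=> x; rewrite !inE mul1mx => /andP[-> /eqP->].
  by rewrite mulmx1 /=.
have leC : (#|C : rker rG|%:R <= (pw R (p ^ \rank W1) / lam R) ^+ k)%R.
  apply: (@le_trans _ _ (\prod_(W : sN) #|C : rstab rG W|)%N%:R%R).
    rewrite ler_nat; apply: leq_trans (leq_index_bigcap _ _ _).
    rewrite -[leqRHS]indexgI; apply: dvdn_leq => //; apply: indexgS.
    by apply: subset_trans (rker_sub_socle sN irrG); rewrite setSI.
  rewrite natr_prod /k -prodr_const; apply: ler_prod => W _; rewrite ler0n /=.
  rewrite ler_pdivlMr ?lam_gt0// -(rW W).
  apply: le_trans (simple_rstabs_bound p_pr solG (Clifford_rstabs_simple irrG W) IH _).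
    rewrite ler_pM2r ?lam_gt0// ler_nat; apply: subset_leq_card; apply: imsetS.
    exact: sCW.
  by rewrite rW.
have <- := Lagrange_index sCG sKC; rewrite natrM.
apply: le_trans (ler_wpM2r (ltW (lam_gt0 R)) (ler_pM _ _ le1 leC)) _; rewrite ?ler0n//.
have -> : (p ^ n = (p ^ \rank W1) ^ k)%N by rewrite -expnM mulnC rkE.
have k0 : (0 < k)%N by apply: ltnW.
by rewrite !pwX mulrAC -exprSr prednK// -exprMn mulrC divfK ?gt_eqF ?lam_gt0.
Qed.
End Imprimitive.

(** * Linear groups: the homogeneous case *)

Section HomogeneousAbelian.
Variables (F : finFieldType) (gT : finGroupType) (G U : {group gT}) (n' : nat).
Local Notation n := n'.+1.
Variables (rG : mx_representation F G n) (nsUG : U <| G).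
Hypotheses (irrG : mx_irreducible rG) (ffulG : mx_faithful rG) (cUU : abelian U).
Let sUG := normal_sub nsUG.
Let rU := subg_repr rG sUG.
Variable sU : socleType rU.
Hypothesis homU : (#|sU| <= 1)%N.
Local Notation E_U := (enveloping_algebra_mx rU).

(* A singular [A] would kill a simple submodule, hence all its isomorphic copies. *)
Lemma homogeneous_unit A : (A \in E_U)%MS -> A != 0%R -> A \in unitmx.
Proof.
move=> EA; apply: contraNT => nuA.
have cA : centgmx rU A.
  apply/centgmxP=> x Ux; have [a ->] := envelop_mxP EA.
  rewrite mulmx_suml mulmx_sumr; apply: eq_bigr => y Uy.
  by rewrite -scalemxAl -scalemxAr -!repr_mxM// (centsP cUU _ Uy _ Ux).
have modK := kermx_centg_module cA.
have nzK : kermx A != 0%R by rewrite kermx_eq0 row_free_unit.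
apply: (mxsimple_exists modK nzK) => [[M simM sMK]].
have [W isoWM] := Socle_iso sU simM.
have M1 : (1%:M <= W)%MS.
  rewrite -(Clifford_Socle1 irrG sU); apply/sumsmx_subP=> W' _.
  by rewrite (fintype_le1P homU W' W).
have simW := socle_simple W.
have [I [V_ isoV defW]] := component_mx_def simW.
rewrite -[A]mul1mx -submx0; apply: submx_trans (submxMr A M1) _.
rewrite /socle_val defW sumsmxMr; apply/sumsmx_subP=> i _.
have [f uf homf eqf] := mx_iso_trans (mx_iso_sym isoWM) (isoV i).
by rewrite -(eqmxMr _ eqf) -(hom_envelop_mxC homf EA) (sub_kermxP sMK) mul0mx.
Qed.

Lemma envelop_mxB A B : (A \in E_U -> B \in E_U -> (A - B)%R \in E_U)%MS.
Proof. by move=> EA EB; rewrite linearB addmx_sub// eqmx_opp. Qed.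

Lemma homogeneous_sub_unit x y : x \in U -> y \in U -> x != y ->
  (rG x - rG y)%R \in unitmx.
Proof.
move=> Ux Uy nxy; apply: homogeneous_unit.
  exact: (envelop_mxB (envelop_mx_id rU Ux) (envelop_mx_id rU Uy)).
rewrite subr_eq0; apply: contraNneq nxy => exy; apply/eqP.
by apply: (mx_faithful_inj ffulG); rewrite ?(subsetP sUG).
Qed.

Lemma homogeneous_cyclic : cyclic U.
Proof.
apply: (@div_ring_mul_group_cyclic _ _ 'M[F]_n rG) => //.
- exact: repr_mx1.
- by move=> x y Ux Uy; rewrite repr_mxM ?(subsetP sUG).
move=> x /setD1P[nx1 Ux]; rewrite -[1%R]/(1%:M)%R -(repr_mx1 rG).
exact: homogeneous_sub_unit.
Qed.

Local Notation t := (\rank E_U).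

(** For a nonzero [v] in [M], the map sending [A] to [v *m A] carries [E_U] onto [M], injectively
    because nonzero elements of [E_U] are invertible. *)
Lemma rank_simple_envelop M : mxsimple rU M -> \rank M = t.
Proof.
move=> simM; have nzv := nz_row_mxsimple simM; set v := nz_row M in nzv.
have [_ nzM _] := simM.
rewrite (mxsimple_cyclic simM nzv (nz_row_sub M)) mxrank_gen.
rewrite -[RHS](mxrank_mul_ker _ (lin_mul_row v)) -[LHS]addn0; congr (_ + _)%N.
apply/esym/eqP; rewrite mxrank_eq0 -submx0; apply/row_subP=> i.
set r := row i _; have: (r <= annihilator_mx rU v)%MS by apply: row_sub.
rewrite -[r]vec_mxK => /annihilator_mxP[EA vA].
have [->|nzA] := eqVneq (vec_mx r) 0%R; first by rewrite linear0 sub0mx.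
case/negP: nzv; apply/eqP.
by rewrite -(mulmxK (homogeneous_unit EA nzA) v) vA mul0mx.
Qed.

(** Distinct elements of [U] have an invertible difference, so [U] acts freely on the nonzero
    vectors of a simple module. *)
Lemma card_homogeneous : (#|U| <= (#|F| ^ t).-1)%N.
Proof.
apply: (mxsimple_exists (mxmodule1 rU) _) => [|[M simM _]].
  by rewrite -mxrank_eq0 mxrank1.
have nzv := nz_row_mxsimple simM; set v := nz_row M in nzv.
rewrite -(rank_simple_envelop simM) -card_rowg.
have -> : (#|rowg M|.-1 = #|rowg M :\ 0%R|)%N.
  by rewrite (cardsD1 0%R (rowg M)) mem_rowg sub0mx.
have injv : {in U &, injective (fun x => v *m rG x)%R}.
  move=> x y Ux Uy /eqP; rewrite -subr_eq0 -mulmxBr => /eqP vxy.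
  apply/eqP; apply: contraNT nzv => /(homogeneous_sub_unit Ux Uy) uxy.
  by rewrite -(mulmxK uxy v) vxy mul0mx.
rewrite -(card_in_imset injv); apply: subset_leq_card.
apply/subsetP=> _ /imsetP[x Ux ->]; rewrite in_setD1 mem_rowg.
rewrite -(mul0mx _ (rG x)) (can_eq (repr_mxK rG (subsetP sUG x Ux))) nzv /=.
have /mxmoduleP modM := mxsimple_module simM.
by apply: submx_trans (modM x Ux); rewrite submxMr// nz_row_sub.
Qed.

Lemma degree_mxminpoly_envelop x : x \in U -> (degree_mxminpoly (rG x) <= t)%N.
Proof.
move=> Ux; rewrite -(eqP (minpoly_mx_free (rG x))) mxrankS//.
apply/row_subP=> i; rewrite rowK; elim: (nat_of_ord i) => [|k IH].
  by rewrite expr0 (envelop_mx1 rU).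
by rewrite exprS; apply: (envelop_mxM (envelop_mx_id rU Ux) IH).
Qed.

(** The conjugates of a generator [x] of [U] are roots of the minimal polynomial of [rG x], of
    degree at most [t]. They commute and differ by units, so even in a matrix ring there are no more
    of them than the degree. *)
Lemma index_cent_homogeneous : (#|G : 'C_G(U)| <= t)%N.
Proof.
have /cyclicP[x defU] := homogeneous_cyclic.
have Ux : x \in U by rewrite defU cycle_id.
have Gx := subsetP sUG x Ux.
have -> : 'C_G(U) = 'C_G[x] by rewrite defU cent_cycle.
rewrite index_cent1 -ltnS.
apply: (@leq_trans (degree_mxminpoly (rG x)).+1); last by rewrite ltnS degree_mxminpoly_envelop.
have sxU : x ^: G \subset U by rewrite class_sub_norm ?normal_norm.
have nzp : map_poly (fun c : F => (c%:M : 'M_n)) (mxminpoly (rG x)) != 0%R.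
  rewrite map_poly_eq0_id0; first exact/monic_neq0/mxminpoly_monic.
  by rewrite (monicP (mxminpoly_monic _)) oner_neq0.
rewrite -(size_mxminpoly (rG x)) cardE -(size_map rG).
have -> : size (mxminpoly (rG x)) = size (map_poly (fun c : F => (c%:M : 'M_n)) (mxminpoly (rG x))).
  rewrite size_map_inj_poly //; last by apply/matrixP=> i j; rewrite !mxE mul0rn.
  by move=> a b /matrixP/(_ ord0 ord0); rewrite !mxE eqxx.
apply: (@max_ring_poly_roots 'M[F]_n _ _ nzp).
  apply/allP=> z /mapP[y]; rewrite mem_enum => /imsetP[g Gg ->] ->.
  have E0 : horner_mx (invmx (rG g) *m rG x *m rG g) (mxminpoly (rG x)) = 0%R.
    rewrite (horner_mx_uconjC _ _ (repr_mx_unit rG Gg)) (mx_root_minpoly (rG x)).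
    by rewrite (mulmx0 _ (invmx (rG g))) (mul0mx _ (rG g)).
  apply/rootP; rewrite -[RHS]E0.
  rewrite conjgE !repr_mxM ?groupM ?groupV// repr_mxV// mulmxA.
  by [].
have: {subset enum (x ^: G) <= U} by move=> y; rewrite mem_enum; apply: (subsetP sxU).
elim: (enum _) (enum_uniq (x ^: G)) => //= y s IH /andP[ns us] sU'.
rewrite IH ?andbT// => [|z sz]; last by rewrite sU' // inE sz orbT.
apply/allP=> _ /mapP[z sz ->]; have Uy : y \in U by rewrite sU' ?mem_head.
have Uz : z \in U by rewrite sU' // inE sz orbT.
rewrite /diff_roots homogeneous_sub_unit ?andbT//; last by apply: contraNneq ns => <-.
by apply/eqP; rewrite -!repr_mxMr ?(subsetP sUG)// (centsP cUU _ Uy _ Uz).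
Qed.

(** * Subgroups of class two over a homogeneous abelian normal subgroup *)

Section Class2.
Variable B : {group gT}.
Hypotheses (sUB : U \subset B) (sBC : B \subset 'C_G(U)).
Hypotheses (sB'U : [~: B, B] \subset U) (sZU : 'Z(B) \subset U).

Let sBG : B \subset G. Proof. by apply: subset_trans sBC (subsetIl _ _). Qed.

Lemma envelop_cent A b : (A \in E_U)%MS -> b \in B -> (A *m rG b = rG b *m A)%R.
Proof.
move=> EA Bb; have [a ->] := envelop_mxP EA.
rewrite mulmx_suml mulmx_sumr; apply: eq_bigr => y Uy.
have /setIP[Gb cUb] := subsetP sBC b Bb.
rewrite -scalemxAl -scalemxAr; congr (_ *: _)%R.
have Gy := subsetP sUG y Uy.
by rewrite -[LHS](repr_mxM rG Gy Gb) -[RHS](repr_mxM rG Gb Gy) (centP cUb y Uy).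
Qed.

Lemma envelop_comm A A' : (A \in E_U -> A' \in E_U -> A *m A' = A' *m A)%MS%R.
Proof.
move=> EA /envelop_mxP[a ->]; rewrite mulmx_suml mulmx_sumr.
apply: eq_bigr => y Uy; rewrite -scalemxAl -scalemxAr; congr (_ *: _)%R.
exact: envelop_cent (subsetP sUB y Uy).
Qed.

(* Conjugation by [x \in B] multiplies [rG b] by the unit [rG [~ b, x]] of the
   field [E_U], and elements of [B] in distinct cosets of [U = 'Z(B)] give
   distinct characters [x |-> [~ b, x]]: hence Dedekind independence. *)
Lemma class2_free (s : seq gT) (k : gT -> 'M[F]_n) :
    {subset s <= B} -> pairwise (fun x y => x * y^-1 \notin U) s ->
    {in s, forall b, k b \in E_U}%MS -> (\sum_(b <- s) k b *m rG b = 0)%R ->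
  {in s, forall b, k b = 0%R}.
Proof.
elim: s k => // b0 s IH k sB' /= /andP[/allP ds0 ds] Ek.
have Bb0 : b0 \in B by rewrite sB' ?mem_head.
have sB : {subset s <= B} by move=> b sb; rewrite sB' // inE sb orbT.
have Eks b : b \in s -> (k b \in E_U)%MS by move=> sb; rewrite Ek // inE sb orbT.
move=> S0.
have UR b x : b \in B -> x \in B -> [~ b, x] \in U.
  by move=> Bb Bx; rewrite (subsetP sB'U)// mem_commg.
have conj_term x b : x \in B -> b \in b0 :: s ->
    (rG x^-1%g *m (k b *m rG b) *m rG x = k b *m rG [~ b, x] *m rG b)%R.
  move=> Bx sb; have Bb := sB' b sb.
  rewrite mulmxA -(envelop_cent (Ek b sb)) ?groupV// -!mulmxA; congr (_ *m _)%R.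
  have URbx := UR b x Bb Bx.
  have [Gx Gb GR] : [/\ x \in G, b \in G & [~ b, x] \in G].
    by split; [exact: subsetP sBG _ Bx | exact: subsetP sBG _ Bb | exact: subsetP sUG _ URbx].
  rewrite -!repr_mxM ?groupM ?groupV//; congr (rG _).
  have /setIP[_ /centP cUb] := subsetP sBC b Bb.
  by rewrite -(cUb _ URbx) -[RHS]conjg_mulR conjgE.
have ks0 : {in s, forall b, k b = 0%R}.
  move=> b sb; have Bb := sB b sb.
  have : exists2 x, x \in B & [~ b, x] != [~ b0, x].
    have := ds0 b sb; rewrite -(groupV U) invMg invgK => nU.
    apply/exists_inP; apply: contraNT nU; rewrite negb_exists_in => /forall_inP eqR.
    apply: (subsetP sZU); rewrite inE groupM ?groupV//=; apply/centP=> x Bx.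
    apply/commgP/conjg_fixP; rewrite conjMg conjVg !conjg_mulR.
    by rewrite (eqP (negbNE (eqR x Bx))) invMg mulgA mulgK.
  case=> x Bx neR.
  pose k' := fun c => (k c *m (rG [~ c, x] - rG [~ b0, x]))%R.
  have UR0 : [~ b0, x] \in U by apply: UR.
  have term c : c \in b0 :: s -> (rG x^-1%g *m (k c *m rG c) *m rG x
      - rG [~ b0, x] *m (k c *m rG c))%R = (k' c *m rG c)%R.
    move=> sc; rewrite conj_term// [(rG [~ b0, x] *m _)%R]mulmxA.
    by rewrite -(envelop_cent (Ek c sc) (subsetP sUB _ UR0)) -mulmxBl -mulmxBr.
  have k'0 : k' b = 0%R.
    apply: (IH k' sB ds) => // [c sc|].
      apply: (envelop_mxM (Eks _ sc)); have URc := UR c x (sB c sc) Bx.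
      exact: (envelop_mxB (envelop_mx_id rU URc) (envelop_mx_id rU UR0)).
    have : (rG x^-1%g *m (\sum_(c <- b0 :: s) k c *m rG c) *m rG x
           - rG [~ b0, x] *m (\sum_(c <- b0 :: s) k c *m rG c))%R = 0%R.
      by rewrite S0 !mulmx0 mul0mx subrr.
    rewrite mulmx_sumr mulmx_suml mulmx_sumr -sumrB (eq_big_seq _ term) big_cons.
    by rewrite {1}/k' subrr mulmx0 mul0mx add0r.
  have uR := homogeneous_sub_unit (UR b x Bb Bx) (UR b0 x Bb0 Bx) neR.
  by rewrite -(mulmxK uR (k b)) -/(k' b) k'0 mul0mx.
move=> b; rewrite inE => /predU1P[->|/ks0//].
have := S0; rewrite big_cons big_seq big1 => [|b' /ks0->]; last by rewrite mul0mx.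
by rewrite addr0 => /(canRL (repr_mxK rG (subsetP sBG b0 Bb0))) ->; rewrite mul0mx.
Qed.
Lemma transversal_pairwise : pairwise (fun x y => x * y^-1 \notin U)
  (enum [set repr X | X in rcosets U B]).
Proof.
have := enum_uniq [set repr X | X in rcosets U B].
have: {subset enum [set repr X | X in rcosets U B] <= [set repr X | X in rcosets U B]}.
  by move=> x; rewrite mem_enum.
elim: (enum _) => //= x s IH sT /andP[nx us].
rewrite IH ?andbT// => [|y sy]; last by rewrite sT // inE sy orbT.
apply/allP=> y sy; apply: contra nx => Uxy.
have /imsetP[_ /rcosetsP[a _ ->] defx] := sT x (mem_head _ _).
have /imsetP[_ /rcosetsP[b _ ->] defy] := sT y (mem_behead (s := x :: s) sy).
have eUx : U :* x = U :* a by rewrite defx rcoset_repr.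
have eUy : U :* y = U :* b by rewrite defy rcoset_repr.
suff -> : x = y by [].
by rewrite defx defy -eUx -eUy; congr repr; apply/rcoset_eqP; rewrite mem_rcoset.
Qed.

(* With [V] the sum of [d = n / t] copies [v_j *m E_U] of a simple module, the
   independent family [B / U] maps the E_U-coefficients on a transversal of [U]
   injectively into the images of the [v_j], so |E_U|^|B : U| <= |V|^d. *)
Lemma index_class2 : (t %| n)%N && (#|B : U| <= (n %/ t) * (n %/ t))%N.
Proof.
apply: (mxsimple_exists (mxmodule1 rU) _) => [|[M simM _]].
  by rewrite -mxrank_eq0 mxrank1.
have rM := rank_simple_envelop simM.
have nzv := nz_row_mxsimple simM; set v := nz_row M in nzv.
have [X sXG [defV dxV]] := Clifford_basis irrG simM.
have t0 : (0 < t)%N by rewrite -rM lt0n mxrank_eq0; case: simM.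
have nE : n = (#|X| * t)%N.
  rewrite -[LHS](mxrank1 F) -defV (mxdirectP dxV) /= -sum_nat_const.
  apply: eq_bigr => x Xx.
  by rewrite -rM mxrankMfree// row_free_unit repr_mx_unit ?(subsetP sXG).
rewrite [X in (t %| X)%N]nE dvdn_mull//= [X in (X %/ t)%N]nE mulnK//.
set T := [set repr X | X in rcosets U B].
have oT : #|T| = #|B : U|.
  rewrite card_in_imset// => _ _ /rcosetsP[a _ ->] /rcosetsP[b _ ->] eab.
  by rewrite -(rcoset_repr U a) eab rcoset_repr.
have sTB : {subset enum T <= B}.
  move=> x; rewrite mem_enum => /imsetP[_ /rcosetsP[a Ba ->] ->].
  by have /rcosetP[u Uu ->] := mem_repr_rcoset U a; rewrite groupM// (subsetP sUB).
pose comb (f : {ffun gT -> 'rV[F]_(n * n)}) := (\sum_(b in T) vec_mx (f b) *m rG b)%R.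
pose phi f := [ffun x => if x \in X then v *m rG x *m comb f else 0]%R.
pose D := pffun_on (0 : 'rV[F]_(n * n))%R T (rowg E_U).
have Dout f b : f \in D -> b \notin T -> f b = 0%R.
  by case/pffun_onP=> /subsetP sf _; apply: contraNeq => /sf.
have Din f b : f \in D -> (f b <= E_U)%MS.
  move=> Df; have [Tb|/(Dout f b Df)->] := boolP (b \in T); last exact: sub0mx.
  by case/pffun_onP: Df => _ sfE; rewrite -mem_rowg sfE ?image_f.
have inj_phi : {in D &, injective phi}.
  move=> f g Df Dg efg.
  pose h b := (vec_mx (f b) - vec_mx (g b))%R.
  have Eh b : (h b \in E_U)%MS by apply: envelop_mxB; rewrite vec_mxK Din.
  have YE : (\sum_(b <- enum T) h b *m rG b = comb f - comb g)%R.
    by rewrite big_enum -sumrB; apply: eq_bigr => b _; rewrite mulmxBl.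
  have Y0 : (\sum_(b <- enum T) h b *m rG b = 0)%R.
    apply/eqP; rewrite -[X in X == _]mul1mx -submx0.
    apply: submx_trans (submxMr _ (_ : 1%:M <= \sum_(x in X) M *m rG x)%MS) _.
      by rewrite defV.
    rewrite sumsmxMr; apply/sumsmx_subP=> x Xx; have Gx := subsetP sXG x Xx.
    have nzvx : (v *m rG x != 0)%R.
      by rewrite -(mul0mx _ (rG x)) (can_eq (repr_mxK rG Gx)).
    have vxM : (v *m rG x <= M *m rG x)%MS by rewrite submxMr// nz_row_sub.
    rewrite submx0; apply/eqP/row_matrixP=> i; rewrite row0 row_mul.
    have : (row i (M *m rG x) <= cyclic_mx rU (v *m rG x))%MS.
      by rewrite -(mxsimple_cyclic (Clifford_simple simM Gx) nzvx vxM) row_sub.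
    case/cyclic_mxP=> A EA ->; rewrite -mulmxA.
    have -> : (A *m (\sum_(b <- enum T) h b *m rG b) =
               (\sum_(b <- enum T) h b *m rG b) *m A)%R.
      rewrite mulmx_sumr mulmx_suml; apply: eq_big_seq => b /sTB Bb.
      rewrite mulmxA -[RHS]mulmxA -(envelop_cent EA Bb) mulmxA; congr (_ *m _)%R.
      exact: envelop_comm.
    rewrite mulmxA YE mulmxBr.
    have := congr1 (fun F0 : {ffun _} => F0 x) efg; rewrite !ffunE Xx => ->.
    by rewrite subrr mul0mx.
  have h0 := class2_free sTB transversal_pairwise (fun b _ => Eh b) Y0.
  apply/ffunP=> b; have [Tb|nTb] := boolP (b \in T); last by rewrite !Dout.
  have := h0 b; rewrite mem_enum => /(_ Tb)/eqP; rewrite subr_eq0.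
  by move=> /eqP/(can_inj vec_mxK).
have sphi : phi @: D \subset pffun_on (0 : 'rV[F]_n)%R X predT.
  apply/subsetP=> _ /imsetP[f _ ->]; apply/pffun_onP; split=> //.
  by apply/subsetP=> x; rewrite inE ffunE; case: ifP => // _ /eqP.
have := subset_leq_card sphi; rewrite card_in_imset// !card_pffun_on card_rowg oT.
rewrite card_mx mul1n -!expnM leq_exp2l ?card_finNzRing_gt1//.
by rewrite [X in (_ <= X * _)%N -> _]nE mulnAC mulnC leq_pmul2r.
Qed.

(** Here [E_U] consists of scalars, so a nontrivial commutator is the scalar -1; its determinant
    (-1)^n is that of a commutator, hence 1. *)
Lemma class2_dim_even : #|F| = 3%N -> t = 1%N -> ~~ abelian B -> ~~ odd n.
Proof.
move=> F3 t1 nabB.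
have /exists_inP[b Bb /exists_inP[x Bx nR]] : [exists b in B, [exists x in B, [~ b, x] != 1]].
  apply: contraNT nabB => nex; apply/centsP=> b Bb x Bx; apply/commgP.
  apply: contraNT nex => nR; apply/exists_inP; exists b => //.
  by apply/exists_inP; exists x.
have URbx : [~ b, x] \in U by rewrite (subsetP sB'U)// mem_commg.
have [c rc] : exists c, rG [~ b, x] = (c%:M)%R.
  have r1 : (E_U <= mxvec (1%:M : 'M[F]_n))%MS.
    rewrite -(geq_leqif (mxrank_leqif_sup (envelop_mx1 rU))) t1 lt0n mxrank_eq0.
    by rewrite mxvec_eq0 -mxrank_eq0 mxrank1.
  have /sub_rVP[c Ec] := submx_trans (envelop_mx_id rU URbx) r1.
  by exists c; apply: (can_inj mxvecK); rewrite -scalemx1 linearZ.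
have c1 : c != 1%R.
  apply: contraNneq nR => c1; apply/eqP/(mx_faithful_inj ffulG); rewrite ?group1 ?(subsetP sUG)//.
  by rewrite rc c1 repr_mx1.
have [Gb Gx] := (subsetP sBG b Bb, subsetP sBG x Bx).
have dn : (c ^+ n = 1)%R.
  rewrite -det_scalar -rc commgEl conjgE !repr_mxM ?groupM ?groupV// !det_mulmx.
  rewrite !(repr_mxV rG)// !det_inv.
  have := repr_mx_unit rG Gb; have := repr_mx_unit rG Gx; rewrite !unitmxE !unitfE => dx db.
  by field; rewrite db dx.
have c0 : c != 0%R by apply: contraTneq (oner_neq0 F) => c0; rewrite -dn c0 expr0n eqxx.
have : (c ^+ 2 == 1)%R.
  have uc : c \is a GRing.unit by rewrite unitfE.
  have := expg_cardG (in_setT (FinRing.Unit uc)).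
  by rewrite card_finField_unit F3 => /(congr1 val); rewrite FinRing.val_unitX => /eqP.
rewrite sqrf_eq1 (negPf c1) orFb => /eqP cN; apply: contra c1 => on.
by move: dn; rewrite cN -signr_odd on expr1 => ->.
Qed.

(** A commutator z satisfies z^4 = [b^4, x] = 1, because b^4 lies in [U]. In characteristic 2 this
    gives (z - 1)^4 = 0, whereas z - 1 is invertible unless z = 1. *)
Lemma class2_pchar2_abelian : 2 \in [pchar F]%R -> #|B : U| = 4%N -> abelian B.
Proof.
move=> ch2 oB; apply/centsP=> b Bb x Bx; apply/commgP.
have nUB : B \subset 'N(U) by apply: subset_trans (normal_norm nsUG).
have URbx : [~ b, x] \in U by rewrite (subsetP sB'U)// mem_commg.
have Ub4 : b ^+ 4 \in U.
  have Nb := subsetP nUB b Bb.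
  rewrite coset_idr ?groupX// morphX// -oB -card_quotient// expg_cardG//.
  exact: mem_quotient.
have z4 : [~ b, x] ^+ 4 = 1.
  have /setIP[_ /centP cUb] := subsetP sBC b Bb.
  have /setIP[_ /centP cUx] := subsetP sBC x Bx.
  rewrite -commXg; last by apply: cUb.
  by apply/eqP/commgP; apply/commute_sym; apply: cUx.
apply: contraT => z1.
have := homogeneous_sub_unit URbx (group1 U) z1; rewrite repr_mx1.
set A := rG _ => uA; have A4 : (A ^+ 4 = 1)%R.
  by rewrite /A -repr_mxX ?(subsetP sUG)// z4 repr_mx1.
have ch2M : (2%:R = 0 :> 'M[F]_n)%R.
  by rewrite -scaler_nat (pcharf0 ch2) scale0r.
have sq (Y : 'M[F]_n) : ((Y - 1) ^+ 2 = Y ^+ 2 - 1)%R.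
  rewrite sqrrB1 -[(Y *+ 2)%R]mulr_natr ch2M mulr0 subr0.
  by congr (_ + _)%R; apply/eqP; rewrite -addr_eq0 -[(1 + 1)%R]/(2%:R)%R ch2M.
have /unitrX : (A - 1%:M)%R \is a GRing.unit by [].
move/(_ 4); rewrite (exprM _ 2 2) !sq -exprM A4 subrr => /=.
by rewrite unitr0.
Qed.

End Class2.

End HomogeneousAbelian.

(** * Bounding the centraliser of U by a normal subgroup of class two *)

Section Class2Cover.
Variable gT : finGroupType.
Implicit Types (G U D B L N : {group gT}).

Lemma card_Ldiv_cyclic U s : (0 < s)%N -> cyclic U -> (#|'Ldiv_s(U)| <= s)%N.
Proof.
move=> s0 cycU; have cUU := cyclic_abelian cycU.
pose K := Group (group_Ldiv s cUU).
have sKU : K \subset U by apply/subsetP=> x /LdivP[].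
have /cyclicP[g defK] := cyclicS sKU cycU.
have /LdivP[_ gs] : g \in 'Ldiv_s(U) by have := cycle_id g; rewrite -defK.
have -> : #|'Ldiv_s(U)| = #[g] by rewrite orderE -defK.
by apply: dvdn_leq => //; rewrite order_dvdn gs.
Qed.

(* When [D] acts trivially on [B / U] and on [U], adding one generator [b] of
   order [s] modulo the previous subgroup costs at most [s] in the index, since
   the [~ b, d] lie in the s-torsion of the cyclic group [U]. *)
Lemma index_cent_class2 U D B : cyclic U -> U \subset B -> B \subset 'C(U) ->
    D \subset 'C(U) -> [~: B, B] \subset U -> [~: B, D] \subset U ->
  (#|D : 'C_D(B)| <= #|B : U|)%N.
Proof.
move=> cycU; move: {2}_.+1 (ltnSn #|B|) => k.
elim: k => // k IH in B *; rewrite ltnS => leBk sUB cBU cDU sB'U sBDU.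
have [<-|[L maxL sUL]] := maximal_exists sUB.
  by rewrite (setIidPl cDU) !indexgg.
have [ltLB maxLB] := maxgroupP maxL; have sLB := proper_sub ltLB.
have le1 : (#|D : 'C_D(L)| <= #|L : U|)%N.
  apply: IH => //; first exact: leq_trans (proper_card ltLB) leBk.
  - exact: subset_trans cBU.
  - by apply: subset_trans sB'U; apply: commgSS.
  - by apply: subset_trans sBDU; apply: commSg.
have [b Bb nLb] := subsetPn (proper_subn ltLB).
have defB : L <*> <[b]> = B.
  have sLb : L <*> <[b]> \subset B by rewrite join_subG sLB cycle_subG.
  apply/eqP; rewrite eqEsubset sLb; apply/negPn/negP=> nsub.
  have prL : (L <*> <[b]>)%G \proper B by rewrite properE sLb.
  have defL := maxLB _ prL (joing_subl _ _).
  by case/negP: nLb; rewrite -defL mem_gen// inE cycle_id orbT.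
have nLB : B \subset 'N(L).
  rewrite -commg_subr; apply: subset_trans sUL.
  by apply: subset_trans sB'U; rewrite commgSS.
set s := #|B : L|; have s0 : (0 < s)%N by rewrite indexg_gt0.
have Lbs : b ^+ s \in L.
  have Nb := subsetP nLB b Bb.
  by rewrite coset_idr ?groupX// morphX// /s -card_quotient// expg_cardG ?mem_quotient.
have CE : 'C_D(B) = 'C_('C_D(L))[b].
  by rewrite -{1}defB centY cent_cycle setIA.
have sCL : 'C_D(B) \subset 'C_D(L) by rewrite setIS// centS.
rewrite -(Lagrange_index (subsetIl D 'C(L)) sCL) -(Lagrange_index sLB sUL) mulnC.
apply: leq_mul => //.
rewrite [#|_ : _|](congr1 (fun A : {set gT} => #|'C_D(L) : A|) CE) index_cent1.
apply: leq_trans (card_Ldiv_cyclic s0 cycU).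
rewrite -(card_lcoset _ b^-1); apply: subset_leq_card; apply/subsetP=> y.
case/lcosetP=> _ /imsetP[d /setIP[Dd cLd] ->] ->; rewrite -commgEl.
have URbd : [~ b, d] \in U by rewrite (subsetP sBDU)// mem_commg.
apply/LdivP; split=> //; rewrite -commXg.
  by apply/eqP/commgP/commute_sym; apply: (centP cLd).
by apply: (centP (subsetP cBU b Bb)).
Qed.

(** This bounds |N : U| in terms of m = |B : U|. Each chief factor in [B / U] yields a factor 1 /
    [lam]; all but one are given up, and for [B = U] there is none. *)
Definition class2_factor (R : realType) (m : nat) : R :=
  (if m == 1%N then 1 else m%:R * pw R m / lam R)%R.

Lemma class2_factorM (R : realType) (m k : nat) : (0 < m)%N -> (0 < k)%N ->
  (m%:R * pw R m / lam R * class2_factor R k <= class2_factor R (m * k))%R.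
Proof.
rewrite /class2_factor => m0 k0; have lam2 := lam_ge2 R; have lam0 := lam_gt0 R.
case: (eqVneq k 1%N) => [->|k1].
  rewrite muln1 mulr1; case: eqP => // ->.
  by rewrite pw1 mulr1 ler_pdivrMr// mul1r (le_trans _ lam2)// ler1n.
have -> : (m * k == 1)%N = false by apply/negbTE; rewrite muln_eq1 (negPf k1) andbF.
rewrite natrM pwM.
have -> : (m%:R * pw R m / lam R * (k%:R * pw R k / lam R) =
   (m%:R * k%:R * (pw R m * pw R k) / lam R) / lam R)%R by field; rewrite gt_eqF.
rewrite ler_pdivrMr// ler_peMr//; last by rewrite (le_trans _ lam2)// ler1n.
by rewrite !mulr_ge0 ?invr_ge0 ?pw_ge0// ltW.
Qed.

Section Cover.
Variables (R : realType) (G U : {group gT}) (m0 : nat).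
Hypotheses (solG : solvable G) (nsUG : U <| G) (cycU : cyclic U) (IHpw : pw_below R m0).
Hypothesis maxU : forall A : {group gT}, A <| G -> abelian A -> U \subset A -> A :=: U.
Hypothesis ltB : forall B : {group gT}, U \subset B -> B \subset 'C_G(U) ->
  [~: B, B] \subset U -> 'Z(B) \subset U -> (#|B : U| < m0)%N.

Let cUU : abelian U := cyclic_abelian cycU.

Lemma center_class2 B : B <| G -> U \subset B -> B \subset 'C_G(U) -> 'Z(B) = U.
Proof.
move=> nsBG sUB sBC; apply: maxU; first exact: char_normal_trans (center_char B) nsBG.
  exact: center_abelian.
by rewrite subsetI sUB centsC (subset_trans sBC) ?subsetIr.
Qed.

(* [B] is a central product of groups [B1], with [B1 / U] a chief factor of [G]
   inside [N / U], peeled off one at a time: the next one is taken in 'C_N(B1),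
   and [N] acts on [B1 / U] as a group whose order the induction hypothesis bounds. *)
Lemma class2_cover N : N <| G -> U \subset N -> N \subset 'C_G(U) ->
  exists B : {group gT}, [/\ B <| G, U \subset B, B \subset N, [~: B, B] \subset U
    & (#|N|%:R <= #|U|%:R * class2_factor R #|B : U|)%R].
Proof.
move: {2}_.+1 (ltnSn #|N|) => k.
elim: k => // k IH in N *; rewrite ltnS => leNk nsNG sUN sNC.
have nUG := normal_norm nsUG; have sNG := normal_sub nsNG.
have [eNU|neNU] := eqVneq (N : {set gT}) U.
  exists U; split=> //; first by rewrite (commG1P _) ?sub1G.
  by rewrite indexgg /class2_factor eqxx mulr1 eNU.
have nsNG' := quotient_normal U nsNG.
have ntN : N / U != 1.
  rewrite -subG1 quotient_sub1; last exact: subset_trans nUG.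
  by apply: contra neNU => sNU; rewrite eqEsubset sNU.
have [V minV sVN] := minnormal_exists ntN (normal_norm nsNG').
have sVG : V \subset G / U := subset_trans sVN (quotientS U sNG).
have [nVG ntV /is_abelemP[r _ abelV]] := minnormal_solvable minV sVG (quotient_sol U solG).
have nsVG : V <| G / U by apply/andP.
pose B1 := (coset U @*^-1 V)%G.
have sUB1 : U \subset B1 by apply: sub_cosetpre.
have sB1N : B1 \subset N.
  by rewrite -(quotientGK (normalS sUN sNG nsUG)) morphpreS.
have nsB1G : B1 <| G by rewrite -(quotientGK nsUG) cosetpre_normal.
have sB1C := subset_trans sB1N sNC.
have qB1 : B1 / U = V by apply: cosetpreK.
have sB1'U : [~: B1, B1] \subset U.
  rewrite -derg1 der1_min ?(subset_trans (normal_sub nsB1G))// qB1.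
  exact: abelem_abelian abelV.
have ZB1 := center_class2 nsB1G sUB1 sB1C.
have oV : #|V| = #|B1 : U|.
  by rewrite -qB1 card_quotient// (subset_trans (normal_sub nsB1G)).
pose N1 := 'C_N(B1)%G.
have nsN1G : N1 <| G.
  rewrite /normal (subset_trans (subsetIl _ _))//= normsI ?(normal_norm nsNG)//.
  by rewrite norms_cent// normal_norm.
have sUN1 : U \subset N1.
  by rewrite subsetI sUN centsC (subset_trans sB1C) ?subsetIr.
have ltN1 : (#|N1| < #|N|)%N.
  rewrite proper_card// properEneq subsetIl andbT; apply/eqP=> eN1.
  have cB1 : abelian B1 by rewrite /abelian (subset_trans sB1N)// -eN1 subsetIr.
  case/negP: ntV; rewrite -qB1 (maxU nsB1G cB1 sUB1) trivg_quotient; exact: eqxx.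
have [B2 [nsB2G sUB2 sB2N1 sB2'U le2]] :=
  IH N1 (leq_trans ltN1 leNk) nsN1G sUN1 (subset_trans (subsetIl _ _) sNC).
have sB2C : B2 \subset 'C(B1) by apply: subset_trans sB2N1 (subsetIr _ _).
have tiB : B1 :&: B2 = U.
  apply/eqP; rewrite eqEsubset subsetI sUB1 sUB2 !andbT.
  have sZU : 'Z(B1) \subset U by rewrite ZB1.
  exact: subset_trans (setIS _ sB2C) sZU.
have nB12 : B2 \subset 'N(B1) := cents_norm sB2C.
pose B := (B1 <*> B2)%G.
have defB : B = B1 * B2 :> {set gT} by rewrite /= norm_joinEr.
have sB2N : B2 \subset N := subset_trans sB2N1 (subsetIl _ _).
have oB : #|B : U| = (#|B1 : U| * #|B2 : U|)%N.
  apply/eqP; rewrite -(eqn_pmul2l (cardG_gt0 U)) Lagrange; last first.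
    by rewrite (subset_trans sUB1) ?joing_subl.
  rewrite mulnA Lagrange// -(eqn_pmul2l (cardG_gt0 U)) defB mulnC -{1}tiB -mul_cardG.
  by rewrite mulnCA Lagrange.
exists B; split.
- by apply: normalY.
- by rewrite (subset_trans sUB1) ?joing_subl.
- by rewrite join_subG sB1N.
- have nUB : B \subset 'N(U).
    by rewrite join_subG !(subset_trans _ nUG)// normal_sub.
  rewrite -derg1 der1_min// defB quotientMr; last exact: subset_trans (normal_sub nsB2G) nUG.
  by rewrite abelianM !sub_der1_abelian ?derg1// quotient_cents.
(* [D] is the centraliser in [N] of the chief factor. The index |N : D| is bounded by the hypothesis
   on smaller modules, |D : N1| by [index_cent_class2], and |N1| by induction. *)
pose D := (N :&: coset U @*^-1 'C_(G / U)(V))%G.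
have sDN : D \subset N by apply: subsetIl.
have nUD : D \subset 'N(U) := subset_trans sDN (subset_trans sNG nUG).
have nUB1 : B1 \subset 'N(U) := subset_trans (normal_sub nsB1G) nUG.
have sDC : D / U \subset 'C_(G / U)(V) by rewrite sub_quotient_pre// subsetIr.
have sB1DU : [~: B1, D] \subset U.
  rewrite -quotient_cents2// qB1 centsC; exact: subset_trans sDC (subsetIr _ _).
have sN1D : N1 \subset D.
  have sN1N : N1 \subset N by apply: subsetIl.
  have nUN1 := subset_trans sN1N (subset_trans sNG nUG).
  rewrite subsetI sN1N -sub_quotient_pre// subsetI quotientS ?(subset_trans sN1N)//.
  by rewrite -qB1 quotient_cents// subsetIr.
have leD : (#|D : N1| <= #|B1 : U|)%N.
  have sCN1 : 'C_D(B1) \subset N1 by rewrite setSI.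
  apply: leq_trans (dvdn_leq _ (indexgS D sCN1)) _; rewrite ?indexg_gt0//.
  have cUN : N \subset 'C(U) := subset_trans sNC (subsetIr _ _).
  apply: index_cent_class2 => //; [exact: subset_trans sB1N cUN | exact: subset_trans sDN cUN].
have leN : (#|N : D|%:R * lam R <= pw R #|B1 : U|)%R.
  have := pw_minnormal IHpw (quotient_sol U solG) minV sVG.
  rewrite oV ltB ?ZB1// => /(_ isT); apply: le_trans.
  rewrite ler_pM2r ?lam_gt0// ler_nat indexgI.
  apply: (@leq_trans #|G : coset U @*^-1 'C_(G / U)(V)|).
    by apply: subset_leq_card; apply: imsetS.
  have sPG : coset U @*^-1 'C_(G / U)(V) \subset G.
    by rewrite -{2}(quotientGK nsUG) morphpreS// subsetIl.
  rewrite -(@index_quotient_eq _ G U) ?cosetpreK//.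
  by rewrite (subset_trans (subsetIr _ _))// sub_cosetpre.
rewrite -(Lagrange sDN) -(Lagrange sN1D) oB !natrM.
have E0 : (0 < #|B1 : U|)%N by rewrite indexg_gt0.
have E0' : (0 < #|B2 : U|)%N by rewrite indexg_gt0.
apply: le_trans (ler_wpM2l _ (class2_factorM R E0 E0')); rewrite ?ler0n//.
move: leN; rewrite -ler_pdivlMr ?lam_gt0// => leN.
apply: (@le_trans _ _ ((#|U|%:R * class2_factor R #|B2 : U|) * #|B1 : U|%:R
    * (pw R #|B1 : U| / lam R))%R); last first.
  by rewrite le_eqVlt; apply/predU1P; left; field; rewrite gt_eqF ?lam_gt0.
have leD' : (#|D : N1|%:R <= #|B1 : U|%:R :> R)%R by rewrite ler_nat.
rewrite !ler_pM ?mulr_ge0 ?ler0n//.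
Qed.
End Cover.
End Class2Cover.

(** * The order bound for irreducible solvable linear groups *)

Lemma ltn_sqr_exp3 (Q d : nat) : (2 < Q)%N -> (d * d < Q ^ d)%N.
Proof.
move=> Q3; apply: (@leq_trans (3 ^ d)%N); last by case: d => // d; rewrite leq_exp2r.
case: d => [|[|d]] //; elim: d => // d IH; rewrite expnS; lia.
Qed.

Section PalfyWolfBound.
Variable R : realType.

Lemma leq_card_faithful (F : finFieldType) (n' : nat) (gT : finGroupType) (G : {group gT})
    (rG : mx_representation F G n'.+1) :
  mx_faithful rG -> (#|G| <= #|'GL_n'.+1[F]|)%N.
Proof.
move=> ffulG; have injf : {in G &, injective (reprGLm rG)}.
  move=> x y Gx Gy exy; apply: (mx_faithful_inj ffulG) => //.
  by rewrite -!(val_reprGLm rG)// exy.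
by rewrite -(card_in_imset injf); apply: subset_leq_card; apply: subsetT.
Qed.

Lemma faithful_irr_bound (p n' : nat) (gT : finGroupType) (G : {group gT})
    (rG : mx_representation 'F_p G n'.+1) :
  prime p -> solvable G -> mx_irreducible rG -> mx_faithful rG ->
  pw_below R (p ^ n'.+1) -> (#|G|%:R * lam R <= pw R (p ^ n'.+1))%R.
Proof.
move=> p_pr solG irrG ffulG IH.
have p1 := prime_gt1 p_pr; have lam0 := lam_gt0 R.
(* The numerical estimates leave out |V| = 9, where |GL(2, 3)| = 48 is sharp. *)
have [e9|n9] := eqVneq (p ^ n'.+1)%N 9%N.
  have leG : (#|G| <= 48)%N.
    have p3 : p = 3%N.
      have : (p %| 3 ^ 2)%N by rewrite -[(3 ^ 2)%N]/9%N -e9 expnS dvdn_mulr.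
      by rewrite Euclid_dvdX// andbT dvdn_prime2// => /eqP.
    have n1 : n' = 1%N by apply/succn_inj/(@expnI 3%N) => //; rewrite -{1}p3 e9.
    have := leq_card_faithful ffulG; move: (n') n1 => _ ->.
    by rewrite card_GL_2 card_Fp// p3.
  by rewrite e9 /pw powR9_alpha ler_pM2r// ler_nat.
have [U maxU1 _] := @maxgroup_exists _ (fun A => (A <| G) && abelian A) 1%G
  (introT andP (conj (normal1 G) (abelian1 _))).
have [/andP[nsUG cUU] maxU2] := maxgroupP maxU1.
have maxU (A : {group gT}) : A <| G -> abelian A -> U \subset A -> A :=: U.
  by move=> nsAG cAA sUA; rewrite (maxU2 A)// nsAG.
apply: (socle_exists (subg_repr rG (normal_sub nsUG))) => sU.
have [gt1|le1] := ltnP 1 #|sU|.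
  have rk1 : rker rG = 1 by apply/trivgP.
  by have := imprimitive_bound p_pr solG irrG IH gt1; rewrite rk1 indexg1.
have oF : #|'F_p| = p by rewrite card_Fp.
set t := \rank (enveloping_algebra_mx (subg_repr rG (normal_sub nsUG))).
have leU := card_homogeneous irrG ffulG cUU le1; rewrite oF -/t in leU.
have leCt := index_cent_homogeneous irrG ffulG cUU le1; rewrite -/t in leCt.
have cycU := homogeneous_cyclic irrG ffulG cUU le1.
set Q := (p ^ t)%N in leU.
have t0 : (0 < t)%N by apply: leq_trans leCt; rewrite indexg_gt0.
pose d := (n'.+1 %/ t)%N.
have class2 (B : {group gT}) : U \subset B -> B \subset 'C_G(U) ->
    [~: B, B] \subset U -> 'Z(B) \subset U -> ~~ abelian B ->
    [/\ n'.+1 = (d * t)%N, (#|B : U| <= d * d)%N & (2 < Q)%N].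
  move=> sUB sBC sB'U sZU nabB.
  have /andP[/divnK nE leE] := index_class2 irrG ffulG cUU le1 sUB sBC sB'U sZU.
  (* If [Q <= 2] then [U] is trivial, and so is [[~: B, B]]. *)
  split; rewrite // ltnNge; apply: contra nabB => Q2.
  have U1 : U :=: 1 by apply/eqP; rewrite trivg_card_le1 (leq_trans leU)// -subn1 leq_subLR.
  by rewrite /abelian (sameP commG1P eqP) -subG1 -U1.
have ltB (B : {group gT}) : U \subset B -> B \subset 'C_G(U) ->
    [~: B, B] \subset U -> 'Z(B) \subset U -> (#|B : U| < p ^ n'.+1)%N.
  move=> sUB sBC sB'U sZU; have [cBB|nabB] := boolP (abelian B).
    have -> : B :=: U by apply/eqP; rewrite eqEsubset sUB andbT -{1}(center_idP cBB).
    by rewrite indexgg -(exp1n n'.+1) ltn_exp2r.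
  have [-> leE Q3] := class2 B sUB sBC sB'U sZU nabB.
  by rewrite mulnC expnM (leq_ltn_trans leE)// ltn_sqr_exp3.
have nsCG : 'C_G(U) <| G.
  by rewrite /normal subsetIl normsI ?normG// norms_cent// normal_norm.
have sUC : U \subset 'C_G(U) by rewrite subsetI normal_sub.
have [B [nsBG sUB sBC sB'U leC]] :=
  class2_cover solG nsUG cycU IH maxU ltB nsCG sUC (subxx _).
have sZU : 'Z(B) \subset U by rewrite (center_class2 maxU).
have le2 : (#|G|%:R <= (t * Q.-1)%:R * class2_factor R #|B : U|)%R.
  rewrite -(Lagrange (normal_sub nsCG)) mulnC natrM natrM -mulrA.
  rewrite ler_pM ?ler0n ?ler_nat//; apply: le_trans leC _.
  rewrite ler_wpM2r ?ler_nat// /class2_factor; case: ifP => // _.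
  by rewrite !mulr_ge0 ?invr_ge0 ?pw_ge0 ?(ltW lam0) ?ler0n.
apply: le_trans (ler_wpM2r (ltW lam0) le2) _; rewrite /class2_factor.
(* In this case [leC] makes [U] its own centraliser in [G], and the semilinear estimate suffices. *)
have [E1|nE1] := eqVneq #|B : U| 1%N.
  rewrite mulr1; apply: le_trans (pw_semilinear_bound R p1 t0) _.
  apply: pw_le; rewrite leq_exp2l// dvdn_leq//.
  have sU'U : [~: U, U] \subset U by rewrite (commG1P _) ?sub1G.
  by have /andP[] := index_class2 irrG ffulG cUU le1 (subxx U) sUC sU'U (center_sub U).
have nabB : ~~ abelian B.
  by apply: contra nE1 => cBB; rewrite (maxU B)// indexgg.
have [nE leE Q3] := class2 B sUB sBC sB'U sZU nabB.
rewrite mulrA divfK ?gt_eqF// mulrA.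
have -> : (p ^ n'.+1 = Q ^ d)%N by rewrite nE mulnC expnM.
apply: pw_class2_bound; rewrite ?leq_double_expn ?leE ?indexg_gt0//.
have E1 : (1 < #|B : U|)%N by rewrite ltn_neqAle eq_sym nE1 indexg_gt0.
have d1 : (1 < d)%N by move: E1 leE; clear; case: (d) => [|[|]] // E1 /(leq_trans E1).
have E4 : Q = 4%N -> d = 2%N -> #|B : U| != 4%N.
  move=> Q4 d2; apply: contra nabB => /eqP oB.
  have p2 : p = 2%N.
    have : (p %| 2 ^ 2)%N by rewrite -[(2 ^ 2)%N]/4%N -Q4 /Q -(prednK t0) expnS dvdn_mulr.
    by rewrite Euclid_dvdX// andbT dvdn_prime2// => /eqP.
  have ch2 : 2 \in [pchar 'F_p]%R by rewrite p2 pchar_Fp.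
  exact: (class2_pchar2_abelian irrG ffulG cUU le1 sBC sB'U ch2 oB).
(* Now [p = 3], [t = 1] and [d] is the dimension: it is even by the determinant argument, and
   [d = 2] is the case |V| = 9 already treated. *)
have d3 : Q = 3%N -> (3 < d)%N.
  move=> Q3'; have p3 : p = 3%N.
    have : (p %| 3 ^ 1)%N by rewrite -[(3 ^ 1)%N]/3%N -Q3' /Q -(prednK t0) expnS dvdn_mulr.
    by rewrite Euclid_dvdX// andbT dvdn_prime2// => /eqP.
  have t1 : t = 1%N by apply: (@expnI 3%N) => //; rewrite -{1}p3 -/Q Q3'.
  have oF3 : #|'F_p| = 3%N by rewrite oF.
  have nodd : ~~ odd n'.+1 by apply: (class2_dim_even ffulG sBC sB'U oF3 t1 nabB).
  move: n9 nodd; rewrite {1}nE t1 muln1 nE t1 muln1 p3; move: d1; clear.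
  by case: (d) => [|[|[|[|]]]].
have d4 : (2 < d)%N \/ d = 2%N by clear -d1; lia.
move: (leq_trans (leqnn _) Q3); rewrite leq_eqVlt => /predU1P[/esym eQ3|Q4].
  by rewrite eQ3 d3// !orbT.
case: d4 => [d3'|d2]; first by rewrite Q4 d3'.
rewrite d2 eqxx !andbT; move: Q4; rewrite leq_eqVlt => /predU1P[/esym eQ4|->]; last by rewrite orbT.
have := E4 eQ4 d2; rewrite d2 in leE; rewrite eQ4 /=.
by move: leE; clear; case: #|_ : _| => [|[|[|[|[|]]]]].
Qed.

Theorem palfy_wolf_bound (N : nat) : pw_below R N.
Proof.
elim: N => // N IH p gT G n rG p_pr solG irrG; rewrite ltnS leq_eqVlt.
case/predU1P=> [eN|]; last exact: IH.
rewrite -card_quotient ?rker_norm//.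
case: n rG irrG eN => [|n'] rG irrG eN.
  by have [_ /negP[]] := irrG; rewrite -mxrank_eq0 mxrank1.
apply: (faithful_irr_bound (rG := kquo_repr rG)) => //; last by rewrite eN.
- exact: quotient_sol.
- exact/quo_mx_irr.
exact: kquo_mx_faithful.
Qed.

Corollary palfy_wolf_minnormal (gT : finGroupType) (G V : {group gT}) :
  solvable G -> minnormal V G -> V \subset G ->
  (#|G : 'C_G(V)|%:R * lam R <= pw R #|V|)%R.
Proof.
move=> solG minV sVG.
by have := pw_minnormal (@palfy_wolf_bound #|V|.+1) solG minV sVG (leqnn _).
Qed.

End PalfyWolfBound.

(** * Complements of a minimal normal subgroup *)

Section Complements.
Variable gT : finGroupType.
Implicit Types (G L M V W : {group gT}).

Lemma centraliser_complement G V L : abelian V -> V * L = G -> V * 'C_L(V) = 'C_G(V).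
Proof. by move=> cVV defG; rewrite group_modl// defG. Qed.

Lemma normal_centraliser_complement G V L : V <| G -> abelian V -> V * L = G ->
  'C_L(V) <| G.
Proof.
move=> nsVG cVV defG; have sLG : L \subset G by rewrite -defG mulG_subr.
rewrite /normal (subset_trans (subsetIl _ _))//= -{1}defG mulG_subG; apply/andP; split.
  by rewrite cents_norm// centsC subsetIr.
by rewrite normsI ?normG// norms_cent// (subset_trans sLG) ?normal_norm.
Qed.

Lemma pcore_quotient_cent G V p : prime p -> minnormal V G -> p.-abelem V ->
  'O_p(G / 'C_G(V)) = 1.
Proof.
move=> p_pr minV abelV; have [/andP[ntV nVG] _] := mingroupP minV.
have irrV : mx_irreducible (abelem_repr abelV ntV nVG) by apply/abelem_mx_irrP.
pose C := 'C_G(V)%G.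
have nCG : G \subset 'N(C) by rewrite normsI ?normG// norms_cent.
have krC : C \subset rker (abelem_repr abelV ntV nVG) by rewrite rker_abelem.
have irrQ : mx_irreducible (quo_repr krC nCG) by apply/quo_mx_irr.
apply: (pcore_faithful_mx_irr_pchar (pchar_Fp p_pr) irrQ).
by rewrite /mx_faithful rker_quo rker_abelem trivg_quotient.
Qed.

(* For a chief factor [N / C] of [G] above [C = 'C_G(V)], an r-group with r <> p, the
   groups [L :&: N] and [M :&: N] are conjugate by Schur-Zassenhaus modulo
   [R = 'C_L(V)]; if [L] and the conjugate of [M] differed, together they would
   normalise [L :&: N], which would then centralise [V]. *)
Lemma minnormal_complement_conj G V L M : solvable G -> minnormal V G -> V \subset G ->
    V :&: L = 1 -> V * L = G -> maximal M G -> ~~ (V \subset M) ->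
    'C_L(V) \subset M -> exists2 v, v \in V & M :=: L :^ v.
Proof.
move=> solG minV sVG tiVL defG maxM nsVM sRM.
have [nVG ntV abV] := minnormal_solvable minV sVG solG.
have [p p_pr abelV] := is_abelemP abV; have cVV := abelem_abelian abelV.
have nsVG : V <| G by apply/andP.
have sLG : L \subset G by rewrite -defG mulG_subr.
have [ltMG maxM2] := maxgroupP maxM; have sMG := proper_sub ltMG.
have nVM : M \subset 'N(V) := subset_trans sMG nVG.
have defM : V * M = G.
  rewrite -norm_joinEr//; apply/eqP; rewrite eqEsubset join_subG sVG sMG /=.
  apply: contraR nsVM => nsG; have prVM : (V <*> M)%G \proper G.
    by rewrite properE join_subG sVG sMG.
  by rewrite -(maxM2 _ prVM (joing_subr _ _)) joing_subl.
have tiVM : V :&: M = 1.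
  have [_ minV2] := mingroupP minV.
  apply: contraNeq nsVM => ntI; have eVM : V :&: M = V.
    apply: (minV2 (V :&: M)%G); rewrite ?subsetIl// ntI /= -{1}defM mulG_subG.
    rewrite (normsI nVM (normG M)) andbT cents_norm// centsC.
    by rewrite (subset_trans (subsetIl _ _)).
  by rewrite -eVM subsetIr.
have oLM : #|M| = #|L|.
  by apply/eqP; rewrite -(eqn_pmul2l (cardG_gt0 V)) -!TI_cardMg// defM defG.
pose C := 'C_G(V)%G; pose R := 'C_L(V)%G.
have nsRG : R <| G by apply: normal_centraliser_complement cVV defG.
have defC : V * R = C by apply: centraliser_complement.
(* If [V] is central, no chief factor lies above [C]; but then [L = 'C_L(V)] is contained in [M],
   and the orders agree. *)
have [eCG|neCG] := eqVneq (C : {set gT}) G.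
  exists 1; rewrite ?group1// conjsg1; apply/eqP; rewrite eq_sym eqEcard oLM leqnn andbT.
  apply: subset_trans sRM; rewrite subsetI subxx.
  by rewrite (subset_trans sLG)// -eCG subsetIr.
have nsCG : C <| G by rewrite /normal subsetIl normsI ?normG// norms_cent.
have ntQ : G / C != 1.
  rewrite -subG1 quotient_sub1 ?normal_norm//.
  by apply: contra neCG => sGC; rewrite eqEsubset sGC subsetIl.
have [Nb minN sNb] := minnormal_exists ntQ (normG _).
have [nNb ntNb /is_abelemP[r r_pr abelN]] := minnormal_solvable minN sNb (quotient_sol C solG).
pose N := (coset C @*^-1 Nb)%G.
have qN : N / C = Nb by apply: cosetpreK.
have nsNG : N <| G by rewrite -(quotientGK nsCG) cosetpre_normal; apply/andP.
have sNG := normal_sub nsNG.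
have sCN : C \subset N by apply: sub_cosetpre.
have sVC : V \subset C by rewrite subsetI sVG.
have sVN := subset_trans sVC sCN.
have ner : r != p.
  apply: contraNneq ntNb => erp; rewrite -subG1.
  rewrite -(pcore_quotient_cent p_pr minV abelV).
  by apply: pcore_max; [rewrite -erp; apply: abelem_pgroup abelN | apply/andP].
have modN (A : {group gT}) : V * A = G -> V * (A :&: N) = N.
  by move=> defA; rewrite group_modl// defA; apply/setIidPr.
have sRN : R \subset N by rewrite (subset_trans _ sCN)// setSI.
have sRL : R \subset L by apply: subsetIl.
pose T := (L :&: N)%G; pose T1 := (M :&: N)%G.
have sRT : R \subset T by rewrite subsetI sRL.
have sRT1 : R \subset T1 by rewrite subsetI sRM.
have nRG := normal_norm nsRG.
have oT : #|T1| = #|T|.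
  apply/eqP; rewrite -(eqn_pmul2l (cardG_gt0 V)) -!TI_cardMg ?modN//.
    by apply/trivgP; rewrite -tiVL setIS// subsetIl.
  by apply/trivgP; rewrite -tiVM setIS// subsetIl.
have nRT : T \subset 'N(R) by rewrite (subset_trans _ nRG)// (subset_trans (subsetIl _ _)).
have nRT1 : T1 \subset 'N(R) by rewrite (subset_trans _ nRG)// (subset_trans (subsetIl _ _)).
have nRV := subset_trans sVG nRG.
have rT : r.-group (T / R).
  have iTR : #|T / R| = #|T / C|.
    have sTG : T \subset G := subset_trans (subsetIr _ _) sNG.
    rewrite !card_quotient ?(subset_trans sTG) ?normal_norm// -[RHS]indexgI.
    suff -> : T :&: C = R by [].
    apply/eqP; rewrite eqEsubset setISS ?subsetIl ?subsetIr//=.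
    by rewrite subsetI sRT setSI.
  rewrite /pgroup iTR; apply: pgroupS (abelem_pgroup abelN).
  by rewrite -qN quotientS ?subsetIr.
have [xb Vxb eT] : exists2 xb, xb \in V / R & T1 / R = (T / R) :^ xb.
  apply: SchurZassenhaus_trans_sol.
  - by rewrite quotient_sol// abelian_sol.
  - by rewrite quotient_norms// (subset_trans (subsetIl _ _))// (subset_trans sLG).
  - by rewrite -quotientMl// modN// quotientS ?subsetIr.
  - apply: pnat_coprime (quotient_pgroup _ (abelem_pgroup abelV)) _.
    by apply: sub_in_pnat rT => q _ /eqP->; rewrite !inE ner.
  by rewrite !card_quotient// -!divgS// oT.
have [x nRx Vx defx] := morphimP Vxb.
have eT1 : T1 :=: T :^ x.
  have nsRT1 : R <| T1 by rewrite /normal sRT1.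
  have nsRTx : R <| T :^ x by rewrite -(normP nRx) normalJ /normal sRT.
  have := quotientGK nsRTx; rewrite /= quotientJ// -defx -eT => <-.
  by rewrite (quotientGK nsRT1).
exists x => //; apply/eqP; rewrite eqEcard cardJg oLM leqnn andbT.
have Gx := subsetP sVG x Vx.
have maxMx : maximal (M :^ x^-1) G.
  by rewrite -(conjGid (groupVr Gx)) maximalJ.
rewrite -sub_conjgV; apply: contraR neCG => nsML.
have [ltMx maxMx2] := maxgroupP maxMx.
have defG2 : (M :^ x^-1) <*> L = G.
  have sMxL : (M :^ x^-1) <*> L \subset G.
    by rewrite join_subG (proper_sub ltMx).
  apply/eqP; rewrite eqEsubset sMxL; apply: contraR nsML => nsG.
  have prJ : ((M :^ x^-1) <*> L)%G \proper G by rewrite properE sMxL.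
  have eJ := maxMx2 _ prJ (joing_subl _ _).
  have sLM : L \subset ((M :^ x^-1) <*> L)%G by apply: joing_subr.
  rewrite eJ /= in sLM; rewrite (_ : M :^ x^-1 = L)//; apply/eqP.
  by rewrite eq_sym eqEcard sLM cardJg oLM leqnn.
have nTG : G \subset 'N(T).
  rewrite -defG2 join_subG; apply/andP; split; last first.
    by rewrite normsI ?normG// (subset_trans sLG)// normal_norm.
  have eT' : T = T1 :^ x^-1 :> {set gT} by rewrite eT1 conjsgK.
  by rewrite eT' /= normJ conjSg normsI ?normG// (subset_trans sMG)// normal_norm.
have sTC : T \subset C.
  rewrite subsetI (subset_trans (subsetIr _ _))//=; apply/commG1P.
  apply/trivgP; rewrite -tiVL subsetI; apply/andP; split.
    by rewrite commg_subr (subset_trans _ nVG)// (subset_trans (subsetIr _ _)).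
  rewrite (subset_trans _ (subsetIl L N))// commg_subl.
  exact: subset_trans sVG nTG.
case/eqP: ntNb; rewrite -qN; apply/trivgP; rewrite -(trivg_quotient C) quotientS//.
by rewrite -(modN L defG) mulG_subG sVC.
Qed.
End Complements.

(** * Maximal intersections above a complement *)

Section Meets.
Variable gT : finGroupType.
Implicit Types (G H L M V W : {group gT}).

Lemma meet_inP G (Ms : seq {group gT}) x :
  reflect (x \in G /\ forall M, M \in Ms -> x \in M) (x \in meet_in G Ms).
Proof.
suff E : (x \in \bigcap_(M <- Ms) gval M) = all (fun M : {group gT} => x \in M) Ms.
  rewrite inE E; apply: (iffP andP) => [[Gx /allP MsP]|[Gx MsP]]; split=> //.
  exact/allP.
by elim: Ms => [|M Ms IH]; rewrite ?big_nil ?inE// big_cons inE IH.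
Qed.

Lemma maximal_over_meetP G (C : {set gT}) x :
  reflect (x \in G /\ forall M, maximal M G -> C \subset M -> x \in M)
    (x \in maximal_over_meet G C).
Proof.
rewrite inE; apply: (iffP andP) => [[Gx /bigcapP MP]|[Gx MP]]; split=> //.
  by move=> M maxM sCM; apply: MP; rewrite maxM.
by apply/bigcapP=> M /andP[maxM sCM]; apply: MP.
Qed.

Lemma maximal_complement G V L : minnormal V G -> V \subset G -> abelian V ->
  V :&: L = 1 -> V * L = G -> maximal L G.
Proof.
move=> minV sVG cVV tiVL defG; have [/andP[ntV nVG] minV2] := mingroupP minV.
have sLG : L \subset G by rewrite -defG mulG_subr.
have oG : #|G| = (#|V| * #|L|)%N by rewrite -defG TI_cardMg.
apply/maxgroupP; split.
  rewrite properEcard sLG oG -[X in (X < _)%N]mul1n ltn_pmul2r//.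
  by rewrite ltnNge -trivg_card_le1.
move=> M ltMG sLM; have sMG := proper_sub ltMG.
have defM : (V :&: M) * L = M.
  by rewrite setIC group_modr// defG; apply/setIidPl.
suff tiVM : V :&: M = 1 by apply/val_inj; rewrite /= -defM tiVM mul1g.
apply: contraTeq ltMG => ntI; suff eVM : V :&: M = V.
  by rewrite properE -{2}defM eVM defG subxx andbF.
apply: (minV2 (V :&: M)%G); rewrite ?subsetIl// ntI /= -{1}defG mulG_subG.
apply/andP; split; last first.
  by rewrite normsI ?(subset_trans sLG nVG) ?(subset_trans sLM) ?normG.
by rewrite cents_norm// centsC (subset_trans (subsetIl _ _)).
Qed.

Lemma conj_complementP V L w x : V :&: L = 1 -> L \subset 'N(V) -> w \in V ->
  x \in L -> (x \in L :^ w) = (x \in 'C[w]).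
Proof.
move=> tiVL nVL Vw Lx; apply/idP/cent1P => [|cwx]; last first.
  have xw : x ^ w = x by apply/conjg_fixP/commgP.
  by rewrite -xw memJ_conjg.
rewrite mem_conjg => Lxw; apply/commgP.
have VR : x^-1 * x ^ w^-1 \in V.
  rewrite -commgEl commgEr groupM ?groupV// invgK.
  by rewrite memJ_norm ?groupV// (subsetP nVL) ?groupV.
have : x^-1 * x ^ w^-1 \in V :&: L by rewrite inE VR groupM ?groupV.
rewrite tiVL => /set1P; rewrite -commgEl => /eqP/commgP cx.
by apply/commgP; rewrite -[w]invgK; apply: commuteV.
Qed.

Lemma cent_complement_meet G V L W : V :&: L = 1 -> V * L = G -> V <| G -> W \subset V ->
  'C_L(W) = meet_in G [seq (L :^ w)%G | w <- enum W].
Proof.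
move=> tiVL defG nsVG sWV; have sLG : L \subset G by rewrite -defG mulG_subr.
have nVL := subset_trans sLG (normal_norm nsVG).
apply/setP=> x; apply/setIP/meet_inP => [[Lx cWx]|[Gx MsP]].
  split=> [|M /mapP[w]]; first exact: subsetP sLG x Lx.
  rewrite mem_enum => Ww -> /=; rewrite (conj_complementP tiVL)// ?(subsetP sWV)//.
  by rewrite cent1E eq_sym (centP cWx).
have Lx : x \in L.
  (* The identity of [W] contributes [L] itself. *)
  have := MsP (L :^ 1)%G; rewrite /= conjsg1; apply.
  by apply/mapP; exists 1; rewrite ?mem_enum ?group1.
split=> //; apply/centP=> w Ww.
have : x \in (L :^ w)%G by apply: MsP; apply/mapP; exists w; rewrite ?mem_enum.
rewrite /= (conj_complementP tiVL)// ?(subsetP sWV)// => /cent1P.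
by [].
Qed.

End Meets.

Section Core.
Variable R : realType.

Lemma complement_index (gT : finGroupType) (G V L : {group gT}) :
  V :&: L = 1 -> V * L = G -> #|G : L| = #|V|.
Proof.
move=> tiVL defG; have sLG : L \subset G by rewrite -defG mulG_subr.
by rewrite -divgS// -defG TI_cardMg// mulnK.
Qed.

(** The summand 1 of the constant accounts for |G : L| = |V|, and alpha for |L : C_L(W)| <= |G :
    C_G(V)|; the factor [lam] is dropped. *)
Lemma complement_index_bound (gT : finGroupType) (G V L W : {group gT}) :
  solvable G -> minnormal V G -> V \subset G -> V :&: L = 1 -> V * L = G ->
  W \subset V -> (#|G : 'C_L(W)|%:R <= #|V|%:R `^ palfy_wolf R)%R.
Proof.
move=> solG minV sVG tiVL defG sWV.
have sLG : L \subset G by rewrite -defG mulG_subr.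
have V0 : (#|V|%:R != 0 :> R)%R by rewrite pnatr_eq0 -lt0n cardG_gt0.
rewrite palfy_wolfE powRD ?V0 ?implybT// powRr1 ?ler0n//.
rewrite -(Lagrange_index sLG (subsetIl L 'C(W))) (complement_index tiVL defG).
rewrite natrM ler_wpM2l//; have := palfy_wolf_minnormal R solG minV sVG.
apply: le_trans; rewrite -[leLHS]mulr1 ler_pM ?ler0n//; last first.
  by rewrite (le_trans _ (lam_ge2 R))// ler1n.
rewrite ler_nat; apply: (@leq_trans #|L : 'C_L(V)|).
  by apply: dvdn_leq => //; rewrite indexgS// setIS// centS.
rewrite indexgI -(indexgI L) -(indexgI G) setIA setIid indexgI.
by rewrite indexgI; apply: subset_leq_card; apply: imsetS.
Qed.

(* 'C_L(W) is the intersection of the conjugates [L :^ w], [w \in W]. In a cheap family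
   with the same intersection, each member not containing [V] is some [L :^ v], and
   these [v] are the required vectors. *)
Lemma generators_of_intersection (gT : finGroupType) (G V L W : {group gT}) (eta : R) :
  solvable G -> (0 < eta)%R -> intersection_property eta G ->
  minnormal V G -> V \subset G -> V :&: L = 1 -> V * L = G -> W \subset V ->
  exists vs : seq gT,
  [/\ {subset vs <= V}, (0 < size vs <= Num.truncn (eta * palfy_wolf R)%R)%N,
      {in vs, forall v, 'C_G(W) \subset 'C[v]}
    & forall x, x \in maximal_over_meet G 'C_G(W) ->
        {in vs, forall v, x \in 'C[v]} -> x \in 'C(W)].
Proof.
move=> solG eta0 etaG minV sVG tiVL defG sWV.
have [nVG ntV abV] := minnormal_solvable minV sVG solG.
have [p p_pr abelV] := is_abelemP abV; have cVV := abelem_abelian abelV.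
have nsVG : V <| G by apply/andP.
have sLG : L \subset G by rewrite -defG mulG_subr.
have nVL := subset_trans sLG nVG.
have maxL := maximal_complement minV sVG cVV tiVL defG.
have defK := cent_complement_meet tiVL defG nsVG sWV.
have [Ms [maxMs KE leMs]] : exists Ms : seq {group gT},
    [/\ forall M, M \in Ms -> maximal M G, 'C_L(W) = meet_in G Ms
      & (\prod_(M <- Ms) (#|G : M|%:R : R) <= (#|G : 'C_L(W)|%:R : R) `^ eta)%R].
  apply: (etaG 'C_L(W)%G); exists [seq (L :^ w)%G | w <- enum W]; split=> // M.
  case/mapP=> w; rewrite mem_enum => Ww -> /=.
  by rewrite -(conjGid (subsetP (subset_trans sWV sVG) w Ww)) maximalJ.
have sKM M : M \in Ms -> 'C_L(W) \subset M.
  move=> MsM; apply/subsetP=> x; rewrite KE => /meet_inP[_ MsP]; exact: MsP.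
have sRK : 'C_L(V) \subset 'C_L(W) by rewrite setIS// centS.
have conjM M : M \in Ms -> ~~ (V \subset M) -> exists2 v, v \in V & M :=: L :^ v.
  move=> MsM nVM; apply: minnormal_complement_conj (maxMs M MsM) nVM _ => //.
  exact: subset_trans sRK (sKM M MsM).
pose Ns := [seq M <- Ms | ~~ (V \subset gval M)].
pose vec (M : {group gT}) := odflt 1 [pick v in V | M :==: L :^ v].
have vecP M : M \in Ns -> vec M \in V /\ M :=: L :^ vec M.
  rewrite mem_filter /vec => /andP[nVM MsM]; have [v Vv Mv] := conjM M MsM nVM.
  case: pickP => [v' /andP[Vv' /eqP]|/(_ v)] //=.
  by rewrite Vv Mv eqxx.
have sNM M : M \in Ns -> M \in Ms by rewrite mem_filter => /andP[].
have defC : V * 'C_L(W) = 'C_G(W).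
  by rewrite group_modl ?defG// centsC (subset_trans sWV).
exists (map vec Ns); split.
- by move=> _ /mapP[M /vecP[VvM _] ->].
(* If every member contained [V], so would their intersection ['C_L(W)], which meets [V] trivially.
   This makes the bound positive. *)
- apply/andP; split.
    rewrite size_map lt0n size_eq0; apply: contraNneq ntV => Ns0.
    rewrite -subG1 -tiVL subsetI subxx.
    apply: subset_trans (subsetIl L 'C(W)).
    rewrite KE; apply/subsetP=> x Vx; apply/meet_inP; split=> [|M MsM].
      exact: subsetP sVG x Vx.
    apply: subsetP Vx; apply: contraT => nVM.
    by have := mem_filter (fun M : {group gT} => ~~ (V \subset M)) M Ms; rewrite -/Ns Ns0 nVM MsM.
  have V1 : (1 < #|V|%:R :> R)%R by rewrite ltr1n ltnNge -trivg_card_le1.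
  have lnV0 : (0 < ln (#|V|%:R : R))%R by rewrite ln_gt0.
  have pw0 : (0 <= palfy_wolf R)%R by rewrite palfy_wolfE addr_ge0// alpha_ge0.
  rewrite size_map truncn_ge_nat ?mulr_ge0 ?(ltW eta0)//.
  rewrite -(ler_pM2r lnV0) -mulrA -!ln_powR.
  rewrite ler_ln ?posrE ?powR_gt0 ?(lt_trans ltr01 V1)// powR_mulrn ?ler0n//.
  apply: (@le_trans _ _ ((#|G : 'C_L(W)|%:R : R) `^ eta)%R); last first.
    rewrite ge0_ler_powR ?nnegrE ?(ltW eta0) ?ler0n ?powR_ge0//.
    exact: complement_index_bound solG minV sVG tiVL defG sWV.
  apply: le_trans leMs; rewrite (bigID (fun M : {group gT} => V \subset M))/=.
  have indM M : M \in Ns -> #|G : M| = #|V|.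
    move=> NsM; have [VvM ->] := vecP M NsM; have GvM := subsetP sVG _ VvM.
    by rewrite -{1}(conjGid GvM) indexJg (complement_index tiVL defG).
  have -> : (#|V|%:R ^+ size Ns = \prod_(M <- Ms | ~~ (V \subset gval M)) (#|G : M|%:R : R))%R.
    rewrite -big_filter -/Ns (eq_big_seq (fun _ => #|V|%:R%R)) => [|M /indM-> //].
    by rewrite big_const_seq count_predT; elim: (size Ns) => //= k <-; rewrite exprS.
  (* The members containing [V] contribute a factor that is at least 1. *)
  rewrite ler_peMl ?prodr_ge0//.
  elim: (Ms) => [|M Ms' IH]; rewrite ?big_nil// big_cons; case: ifP => // _.
  by rewrite mulr_ege1 ?ler1n ?indexg_gt0.
- move=> _ /mapP[M /[dup] NsM /vecP[Vv eM] ->].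
  rewrite -defC mulG_subG; apply/andP; split.
    by rewrite sub_cent1 (subsetP _ _ Vv).
  apply/subsetP=> x Kx; rewrite -(conj_complementP tiVL nVL Vv); last first.
    by have /setIP[] := Kx.
  by rewrite -eM (subsetP (sKM M (sNM M NsM))).
move=> x /maximal_over_meetP[Gx maxP] vecC.
(* As [V] centralises [W], only the factor [y] in [L] matters. A member containing [V] contains
   ['C_G(W)], hence [x] and [y]; for the other members, centralising the vector is enough. *)
have : x \in V * L by rewrite defG.
case/mulsgP=> v y Vv Ly ex.
have yE : y = v^-1 * x by rewrite ex mulKg.
have sVC : V \subset 'C_G(W) by rewrite -defC mulG_subl.
have Ky : y \in 'C_L(W).
  rewrite KE; apply/meet_inP; split=> [|M MsM]; first exact: subsetP sLG y Ly.
  have [sVM|nVM] := boolP (V \subset M).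
    have sCM : 'C_G(W) \subset M by rewrite -defC mulG_subG sVM sKM.
    by rewrite yE groupM ?groupV ?maxP ?maxMs// (subsetP sVM).
  have NsM : M \in Ns by rewrite mem_filter nVM.
  have [VvM ->] := vecP M NsM; rewrite (conj_complementP tiVL nVL VvM)//.
  rewrite yE groupM ?groupV ?vecC ?map_f//.
  by apply/cent1P; apply: (centsP cVV).
by rewrite ex groupM//; [have /setIP[] := subsetP sVC v Vv | have /setIP[] := Ky].
Qed.
End Core.

(** * Passage to the quotient by the lower term of the chief factor *)

Section Quotient.
Variables (gT : finGroupType) (G Y : {group gT}).
Hypothesis nsYG : Y <| G.

Lemma mem_quotient_coset (A : {group gT}) x : Y <| A -> x \in 'N(Y) ->
  (coset Y x \in A / Y) = (x \in A).
Proof.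
move=> nsYA Nx; apply/idP/idP=> [qx|]; last exact: mem_quotient.
by rewrite -(quotientGK nsYA) mem_morphpre.
Qed.

Lemma maximal_cosetpre (M : {group coset_of Y}) :
  maximal M (G / Y) -> maximal (coset Y @*^-1 M) G.
Proof.
move=> maxM; have sMG : M \subset G / Y := proper_sub (maxgroupp maxM).
have sYM : Y \subset coset Y @*^-1 M by apply: sub_cosetpre.
have sPG : coset Y @*^-1 M \subset G by rewrite -(quotientGK nsYG) morphpreS.
by rewrite -(@quotient_maximal _ Y) ?cosetpreK// (normalS sYM sPG).
Qed.

(** A family in [G] whose intersection is the preimage of [Hb] consists of subgroups containing [Y],
    so it descends to the quotient with the same indices. *)
Lemma intersection_property_quotient (R : realType) (eta : R) :
  intersection_property eta G -> intersection_property eta (G / Y)%G.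
Proof.
move=> etaG Hb [Msb [maxMsb HbE]].
have sHbG : Hb \subset G / Y by rewrite HbE subsetIl.
have sYG := normal_sub nsYG; have nYG := normal_norm nsYG.
pose H := (coset Y @*^-1 Hb)%G.
have sYH : Y \subset H by apply: sub_cosetpre.
have sHG : H \subset G by rewrite -(quotientGK nsYG) morphpreS.
have nsYA (A : {group gT}) : Y \subset A -> A \subset G -> Y <| A.
  by move=> sYA sAG; apply: normalS nsYG.
have qH : H / Y = Hb by apply: cosetpreK.
have [|Ms [maxMs HE leMs]] := etaG H.
  exists [seq (coset Y @*^-1 gval M)%G | M <- Msb]; split.
    by move=> _ /mapP[M /maxMsb maxM ->]; apply: maximal_cosetpre.
  apply/setP=> x; apply/idP/meet_inP => [Hx|[Gx MsP]].
    have Gx := subsetP sHG x Hx; split=> // _ /mapP[M MsM ->] /=.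
    have Nx := subsetP nYG x Gx.
    have [_] := morphpreP Hx; rewrite HbE => /meet_inP[_ MsbP].
    by apply/morphpreP; split; last exact: MsbP.
  have Nx := subsetP nYG x Gx.
  apply/morphpreP; split=> //; rewrite HbE; apply/meet_inP; split=> [|M MsM].
    exact: mem_quotient.
  have /morphpreP[] // : x \in (coset Y @*^-1 M)%G by apply: MsP; apply/mapP; exists M.
have sYMs M : M \in Ms -> Y \subset M.
  move=> MsM; apply: subset_trans sYH _; apply/subsetP=> x; rewrite HE.
  by case/meet_inP=> _; apply.
have nsYMs M : M \in Ms -> Y <| M.
  by move=> MsM; rewrite nsYA ?sYMs// (proper_sub (maxgroupp (maxMs M MsM))).
exists [seq (M / Y)%G | M <- Ms]; split.
- by move=> _ /mapP[M MsM ->] /=; rewrite quotient_maximal ?(nsYMs M MsM) ?(maxMs M MsM).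
- apply/setP=> z; have [x Nx ->] := cosetP z.
  rewrite -qH mem_quotient_coset ?nsYA// HE.
  apply/meet_inP/meet_inP => [[Gx MsP]|[Gx MsP]]; rewrite mem_quotient_coset// in Gx *.
    split=> // _ /mapP[M MsM ->] /=.
    by rewrite (mem_quotient_coset (nsYMs M MsM) Nx) MsP.
  split=> // M MsM; rewrite -(mem_quotient_coset (nsYMs M MsM) Nx).
  by apply: (MsP (M / Y)%G); apply: map_f.
rewrite big_map -qH index_quotient_eq//; last first.
  by rewrite (subset_trans (subsetIr _ _)).
rewrite (eq_big_seq (fun M : {group gT} => #|G : M|%:R%R)) => [|M MsM] //.
rewrite /= index_quotient_eq ?(proper_sub (maxgroupp (maxMs M MsM)))//.
by rewrite (subset_trans (subsetIr _ _)) ?sYMs.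
Qed.

Lemma cent_quotientP (W : {set coset_of Y}) x : x \in G ->
  (x \in 'C_G(W | 'Q)) = (coset Y x \in 'C_(G / Y)(W)).
Proof.
move=> Gx; have Nx := subsetP (normal_norm nsYG) x Gx.
rewrite in_setI Gx astabQ [RHS]in_setI mem_quotient//.
by apply/morphpreP/idP => [[]|Cx] //; split.
Qed.

Lemma maximal_over_meet_quotient (W : {set coset_of Y}) x :
  x \in maximal_over_meet G 'C_G(W | 'Q) ->
  coset Y x \in maximal_over_meet (G / Y)%G 'C_(G / Y)(W).
Proof.
case/maximal_over_meetP=> Gx maxP; apply/maximal_over_meetP; split=> [|M maxM sCM].
  exact: mem_quotient.
have Nx := subsetP (normal_norm nsYG) x Gx.
have: x \in (coset Y @*^-1 M)%G.
  apply: maxP; first exact: maximal_cosetpre.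
  apply/subsetP=> y Cy; have Gy : y \in G by have /setIP[] := Cy.
  have Ny := subsetP (normal_norm nsYG) y Gy.
  apply/morphpreP; split=> //; apply: (subsetP sCM); by rewrite -cent_quotientP.
by case/morphpreP.
Qed.
End Quotient.

(** * Spans over the endomorphism field *)

Section EndomorphismSpan.
Variables (gT rT : finGroupType) (D : {group gT}) (S : {group rT}).
Variables (to : groupAction D S) (G : {group gT}) (V : {group rT}).
Hypotheses (irrV : irreducible_module to G V) (sVS : V \subset S).

Let sGD : G \subset D. Proof. by case: irrV. Qed.
Let cVV : abelian V. Proof. by case: irrV. Qed.

Lemma irreducible_actsP : {in G & V, forall a x, to x a \in V}.
Proof.
have [_ _ /mingroupP[/andP[_ actV] _]] := irrV.
by move=> a x Ga Vx; rewrite (acts_act actV).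
Qed.

(** A decidable form, so that endomorphisms, as finite functions, can be collected in a finite
    set. *)
Definition module_endb (f : rT -> rT) : bool :=
  [&& [forall x in V, f x \in V],
      [forall x in V, [forall y in V, f (x * y) == f x * f y]]
    & [forall a in G, [forall x in V, f (to x a) == to (f x) a]]].

Lemma module_endP f : reflect (module_end to G V f) (module_endb f).
Proof.
apply: (iffP and3P) => [[/forall_inP fV /forall_inP fM /forall_inP fG]|[fV fM fG]].
  split=> // [x y Vx Vy|a x Ga Vx]; first by have /forall_inP/(_ y Vy)/eqP := fM x Vx.
  by have /forall_inP/(_ x Vx)/eqP := fG a Ga.
split; apply/forall_inP=> // x Vx; apply/forall_inP=> y Vy; apply/eqP; first exact: fM.
exact: fG.
Qed.

Lemma module_end_ffun f : module_end to G V f -> module_end to G V [ffun x => f x].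
Proof.
case=> fV fM fG; split=> [x Vx|x y Vx Vy|a x Ga Vx]; rewrite !ffunE ?fV ?fM ?fG//.
Qed.

Lemma module_end_id : module_end to G V id.
Proof. by split. Qed.

Lemma module_end_comp f g : module_end to G V f -> module_end to G V g ->
  module_end to G V (f \o g).
Proof.
move=> [fV fM fG] [gV gM gG]; split=> [x Vx|x y Vx Vy|a x Ga Vx] /=.
- by rewrite fV ?gV.
- by rewrite gM// fM ?gV.
by rewrite gG// fG ?gV.
Qed.

Lemma module_end_const1 : module_end to G V (fun=> 1).
Proof.
split=> // [x y _ _|a x Ga _]; first by rewrite mulg1.
by rewrite gact1 ?(subsetP sGD).
Qed.

Lemma module_endM f g : module_end to G V f -> module_end to G V g ->
  module_end to G V (fun x => f x * g x).
Proof.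
move=> [fV fM fG] [gV gM gG]; split=> [x Vx|x y Vx Vy|a x Ga Vx].
- by rewrite groupM ?fV ?gV.
- rewrite fM// gM// -!mulgA; congr (_ * _); rewrite !mulgA; congr (_ * _).
  by apply: (centsP cVV); rewrite ?fV ?gV.
by rewrite fG// gG// gactM ?(subsetP sGD) ?(subsetP sVS) ?fV ?gV.
Qed.

Lemma module_end1 f : module_end to G V f -> f 1 = 1.
Proof.
by move=> [fV fM _]; apply: (mulgI (f 1)); rewrite -fM ?group1// !mulg1.
Qed.

(** Schur's lemma: the kernel is invariant under [G] and is not all of [V], hence trivial. *)
Lemma module_end_inv f x0 : module_end to G V f -> x0 \in V -> f x0 != 1 ->
  exists2 g, module_end to G V g & {in V, forall x, g (f x) = x}.
Proof.
move=> endf Vx0 nfx0; have [fV fM fG] := endf.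
have gK : group_set [set x in V | f x == 1].
  apply/group_setP; split=> [|x y]; rewrite !inE ?group1 ?(module_end1 endf) //=.
  by move=> /andP[Vx /eqP fx] /andP[Vy /eqP fy]; rewrite groupM// fM// fx fy mulg1 /=.
pose K := Group gK.
have [_ _ /mingroupP[_ minV]] := irrV.
have K1 : K :=: 1.
  apply: contraNeq nfx0 => ntK; have eKV : K :=: V.
    apply: (minV K); last by apply/subsetP=> x; rewrite inE => /andP[].
    rewrite ntK /=; apply/subsetP=> a Ga; rewrite !inE (subsetP sGD)//=.
    apply/subsetP=> x; rewrite !inE => /andP[Vx /eqP fx].
    by rewrite irreducible_actsP// fG// fx gact1 ?(subsetP sGD) /=.
  by have : x0 \in K; [rewrite eKV | rewrite inE => /andP[_ ->]].
have injf : {in V &, injective f}.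
  move=> x y Vx Vy exy; have : x * y^-1 \in K.
    rewrite inE groupM ?groupV//=; apply/eqP/(mulIg (f y)).
    by rewrite -fM ?groupM ?groupV// mulgKV mul1g.
  by rewrite K1 => /set1P/(canRL (mulgK _)); rewrite invgK mul1g.
have imf : f @: V = V.
  apply/eqP; rewrite eqEcard card_in_imset// leqnn andbT.
  by apply/subsetP=> _ /imsetP[x Vx ->]; apply: fV.
pose g y := odflt 1 [pick x in V | f x == y].
have gK1 : {in V, forall x, g (f x) = x}.
  move=> x Vx; rewrite /g; case: pickP => [y /andP[Vy /eqP/injf]|/(_ x)/=]; first exact.
  by rewrite Vx eqxx.
have fsurj y : y \in V -> exists2 x, x \in V & y = f x.
  by rewrite -{1}imf => /imsetP.
exists g => //; split=> [_ /fsurj[x Vx ->]|_ _ /fsurj[x Vx ->] /fsurj[y Vy ->]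
  |a _ Ga /fsurj[x Vx ->]].
- by rewrite gK1.
- by rewrite -fM// !gK1// groupM.
by rewrite -fG// !gK1// irreducible_actsP.
Qed.

Definition end_span (k : nat) (v : 'I_k -> rT) : {group rT} :=
  <<[set (f : {ffun rT -> rT}) (v i)
      | f in [set f : {ffun rT -> rT} | module_endb f], i in 'I_k]>>%G.

Section Span.
Variables (k : nat) (v : 'I_k -> rT).
Hypothesis Vv : forall i, v i \in V.

Lemma end_spanS (H : {group rT}) :
  (forall f i, module_end to G V f -> f (v i) \in H) -> end_span v \subset H.
Proof.
move=> Hv; rewrite gen_subG; apply/subsetP=> _ /imset2P[f i + _ ->].
by rewrite inE => /module_endP endf; apply: Hv.
Qed.

Lemma mem_end_span f i : module_end to G V f -> f (v i) \in end_span v.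
Proof.
move=> endf; apply: mem_gen; apply/imset2P; exists [ffun x => f x] i => //.
  by rewrite inE; apply/module_endP/module_end_ffun.
by rewrite ffunE.
Qed.

Lemma end_span_id i : v i \in end_span v.
Proof. exact: (@mem_end_span id i module_end_id). Qed.

Lemma end_span_sub : end_span v \subset V.
Proof. by apply: end_spanS => f i [fV _ _]; apply: fV. Qed.

Lemma F_subspace_end_span : F_subspace to G V (end_span v).
Proof.
split=> [|f endf x vx]; first exact: end_span_sub.
have [fV fM _] := endf.
have gP : group_set [set y in V | f y \in end_span v].
  apply/group_setP; split=> [|y z]; rewrite !inE; first by rewrite (module_end1 endf) !group1.
  by move=> /andP[Vy fy] /andP[Vz fz]; rewrite fM// !groupM.
suff : x \in Group gP by rewrite inE => /andP[].
move: x vx; apply/subsetP; apply: end_spanS => g i endg; rewrite inE.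
have [gV _ _] := endg; rewrite gV//=.
exact: mem_end_span (module_end_comp endf endg).
Qed.

Lemma prodgM_abelian (I : Type) (r : seq I) (f g : I -> rT) :
  (forall i, f i \in V) -> (forall i, g i \in V) ->
  \prod_(i <- r) (f i * g i) = (\prod_(i <- r) f i) * (\prod_(i <- r) g i).
Proof.
move=> Vf Vg; elim: r => [|i r IH]; first by rewrite !big_nil mulg1.
rewrite !big_cons IH -!mulgA; congr (_ * _); rewrite !mulgA; congr (_ * _).
by apply: (centsP cVV) => //; apply: group_prod.
Qed.

Lemma F_generates_end_span : F_generates to G V (end_span v) v.
Proof.
pose A := [set w | `[< exists f : 'I_k -> rT -> rT,
  (forall i, module_end to G V (f i)) /\ w = \prod_(i < k) f i (v i) >]].
have gA : group_set A.
  apply/group_setP; split=> [|x y]; rewrite !inE.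
    apply/asboolP; exists (fun _ _ => 1); split=> [i|]; first exact: module_end_const1.
    by rewrite big1.
  move=> /asboolP[f [endf ->]] /asboolP[g [endg ->]]; apply/asboolP.
  exists (fun i x => f i x * g i x); split=> [i|]; first exact: module_endM.
  by rewrite prodgM_abelian// => i; [case: (endf i) | case: (endg i)] => hV _ _; apply: hV.
suff sA : end_span v \subset Group gA.
  by move=> w /(subsetP sA); rewrite inE => /asboolP.
apply: end_spanS => f j endf; rewrite inE; apply/asboolP.
exists (fun i => if i == j then f else fun=> 1); split=> [i|].
  by case: eqP => // _; apply: module_end_const1.
rewrite (eq_bigr (fun i => if i == j then f (v i) else 1)) => [|i _]; last by case: eqP.
by rewrite -big_mkcond big_pred1_eq.
Qed.

End Span.

Lemma group_prod_factor (I : eqType) (r : seq I) (a : I -> rT) (H : {group rT}) i0 :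
  uniq r -> i0 \in r -> (forall i, i != i0 -> a i \in H) -> \prod_(i <- r) a i \in H ->
  a i0 \in H.
Proof.
move=> + + Ha; elim: r => //= i r IH /andP[ni ur]; rewrite big_cons inE.
have [ei _|neq /= ri] := eqVneq i0 i.
  rewrite -ei groupMr// big_seq; apply: group_prod => j rj; apply: Ha.
  by apply: contraNneq ni => ej; rewrite -ei -ej.
move=> prodH; apply: (IH ur ri); move: prodH.
by rewrite groupMl// Ha// eq_sym.
Qed.

(** Given a nontrivial relation, some coefficient is invertible by Schur's lemma; its vector lies in
    the span of the others and can be discarded. *)
Lemma F_dim_end_span (k : nat) (v : 'I_k -> rT) : (forall i, v i \in V) ->
  exists2 d, F_dim to G V (end_span v) d & (d <= k)%N.
Proof.
elim: k v => [|k IH] v Vv.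
  exists 0%N => //; exists v; split=> [[]//|f _ _ []//|]; exact: F_generates_end_span.
have [freev|] := pselect (F_free to G V v).
  exists k.+1 => //; exists v; split=> // [i|]; first exact: end_span_id.
  exact: F_generates_end_span.
move=> /existsNP[f /not_implyP[endf /not_implyP[prod1 /existsNP[i0 nf]]]].
have [x Vx nfx] : exists2 x, x \in V & f i0 x != 1.
  apply: contra_notP nf => nex x Vx; apply/eqP; apply: contraT => nfx.
  by case: nex; exists x.
have [g endg gK] := module_end_inv (endf i0) Vx nfx.
pose v' j := v (lift i0 j).
have Vv' j : v' j \in V by apply: Vv.
have [sV' closed'] := F_subspace_end_span Vv'.
have vi0 : v i0 \in end_span v'.
  rewrite -(gK (v i0))//; apply: closed' => //.
  apply: (@group_prod_factor _ (index_enum 'I_k.+1) (fun i => f i (v i))).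
  - exact: index_enum_uniq.
  - exact: mem_index_enum.
  - move=> i; case: (unliftP i0 i) => [j ->|-> /eqP//] _.
    exact: (@mem_end_span _ v' (f (lift i0 j)) j).
  by rewrite prod1 group1.
have eqv : end_span v' :=: end_span v.
  apply/eqP; rewrite eqEsubset; apply/andP; split; apply: end_spanS => h i endh.
    exact: mem_end_span.
  case: (unliftP i0 i) => [j ->|->]; first exact: (@mem_end_span _ v' h j).
  exact: closed'.
have [d dimd led] := IH v' Vv'; exists d; last exact: leqW.
by rewrite -(val_inj eqv).
Qed.

End EndomorphismSpan.

(** Endomorphisms commute with [a], so they preserve its fixed points. *)
Lemma end_span_fixed (gT rT : finGroupType) (D : {group gT}) (S : {group rT})
    (to : groupAction D S) (G V : {group _}) (k : nat) (v : 'I_k -> rT) a :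
  irreducible_module to G V -> V \subset S -> (forall i, v i \in V) -> a \in G ->
  (forall i, to (v i) a = v i) -> {in end_span to G V v, forall w, to w a = w}.
Proof.
move=> irrV sVS Vv Ga va; have [sGD _ _] := irrV; have Da := subsetP sGD a Ga.
have gA : group_set [set w in V | to w a == w].
  apply/group_setP; split=> [|x y]; rewrite !inE; first by rewrite group1 gact1 /=.
  move=> /andP[Vx /eqP ax] /andP[Vy /eqP ay].
  by rewrite groupM// gactM ?(subsetP sVS)// ax ay /=.
suff sA : end_span to G V v \subset Group gA.
  by move=> w /(subsetP sA); rewrite inE => /andP[_ /eqP].
apply: end_spanS => f i [fV _ fG]; rewrite inE fV//=.
by rewrite -fG// va.
Qed.

Theorem theorem9 (R : realType) (gT : finGroupType) (G : {group gT}) (eta : R) :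
  solvable G -> (0 < eta)%R -> intersection_property eta G ->
  forall X Y : {group gT},
    chief_factor G Y X -> [splits G / Y, over X / Y] ->
    gamma_module 'Q%gact G (X / Y)%G (Num.truncn (eta * palfy_wolf R)%R).
Proof.
move=> solG eta0 etaG X Y chiefXY splitXY.
have minV := chief_factor_minnormal chiefXY.
have /andP[maxY nsXG] := chiefXY; have sXG := normal_sub nsXG.
have sYX : Y \subset X by case/maxgroupP: maxY => /andP[/proper_sub].
have nYG : G \subset 'N(Y) by case/maxgroupP: maxY => /andP[].
have nsYG : Y <| G by rewrite /normal (subset_trans sYX).
have nsYX : Y <| X := normalS sYX sXG nsYG.
have sVG : X / Y \subset G / Y by apply: quotientS.
have [L /complP[tiVL defG]] := splitsP splitXY.
have solGY := quotient_sol Y solG.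
have etaGY := intersection_property_quotient nsYG etaG.
have [_ _ /is_abelemP[p _ abelV]] := minnormal_solvable minV sVG solGY.
have irrV : irreducible_module 'Q%gact G (X / Y)%G.
  split; first by have := dom_qactJ Y; rewrite /= => ->.
    exact: abelem_abelian abelV.
  by rewrite (acts_irrQ nYG nsYX).
have sVS : X / Y \subset [set: gT] / Y by apply: quotientS; apply: subsetT.
have gens (W : {group coset_of Y}) : W \subset X / Y -> _ := fun sWV =>
  @generators_of_intersection R _ (G / Y)%G (X / Y)%G L W eta solGY
    eta0 etaGY minV sVG tiVL defG sWV.
split=> //.
  (* Positivity of gamma: already for [W = 1] at least one vector is needed. *)
  have [vs [_ /andP[vs0 vsg] _ _]] := gens 1%G (sub1G _).
  exact: leq_trans vs0 vsg.
move=> W [sWV _]; have [vs [vsV /andP[_ vsg] CW WC]] := gens W sWV.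
pose v i := tnth (in_tuple vs) i.
have vsv i : v i \in vs by apply: mem_tnth.
have Vv i : v i \in X / Y by apply: vsV.
have [d dimd led] := F_dim_end_span irrV sVS Vv.
exists (end_span 'Q%gact G (X / Y)%G v); split.
- exact: F_subspace_end_span.
- by exists d => //; apply: leq_trans led vsg.
have actQ x w : x \in G -> 'Q%act w x = w ^ coset Y x.
  by move=> Gx; rewrite qactJ (subsetP nYG).
apply/setP=> x; rewrite [RHS]in_setI.
have [Gx|nGx] := boolP (x \in G); last by rewrite !in_setI (negPf nGx).
apply/idP/andP=> [CWx|[CWsx maxx]].
  have CWqx : coset Y x \in 'C_(G / Y)(W) by rewrite -cent_quotientP.
  split; last by apply/maximal_over_meetP; split=> // M _ /subsetP; apply.
  rewrite cent_quotientP// in_setI mem_quotient//=; apply/centP=> w Sw.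
  have fixw : 'Q%gact w x = w.
    apply: (end_span_fixed irrV sVS Vv Gx) Sw => i.
    have := subsetP (CW _ (vsv i)) _ CWqx; rewrite /= actQ// => /cent1P cvx.
    by apply/conjg_fixP/commgP.
  by move: fixw; rewrite /= actQ// => /conjg_fixP/commgP.
rewrite cent_quotientP// in_setI mem_quotient//=.
apply: WC => [|w vsw]; first exact: maximal_over_meet_quotient.
have := CWsx; rewrite cent_quotientP// in_setI => /andP[_ /centP cWs].
have /tnthP[i ->] : w \in in_tuple vs by [].
apply/cent1P; apply: cWs; exact: end_span_id.
Qed.
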